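(* Let $\Omega\subset\mathbb{R}^n$ be a bounded open set, let $\xi_0\in\mathbb{R}^n$, and let $f:\mathbb{R}^n\to\mathbb{R}$ be a Borel measurable and level convex function which is strictly level convex at $\xi_0$ in at least one direction. Then $u_{\xi_0}$ is the only solution to the problem $$\inf\Big\{\operatorname*{ess\,sup}_{x\in\Omega}f(\nabla u(x)):\ u\in u_{\xi_0}+W^{1,\infty}_0(\Omega)\Big\}.$$
   Context: Functions $u$ are scalar valued. $W^{1,\infty}_0(\Omega)$ is the closure of $C_0^\infty(\Omega)$ in $W^{1,1}(\Omega)$ intersected with $W^{1,\infty}(\Omega)$. $u_{\xi_0}$ denotes an affine function $u_{\xi_0}(x)=\langle\xi_0,x\rangle+c$ for some $c\in\mathbb{R}$. A function $f:\mathbb{R}^n\to\mathbb{R}$ is level convex if $f(t\xi+(1-t)\eta)\le\max\{f(\xi),f(\eta)\}$ for all $\xi,\eta\in\mathbb{R}^n$, $t\in[0,1]$. A level convex function $f:\mathbb{R}^n\to\mathbb{R}$ is strictly level convex at $\xi_0$ in at least one direction if there exists $\alpha\in\mathbb{R}^n\setminus\{0\}$ such that, whenever $\gamma,\eta\in\mathbb{R}^n$ and $t\in(0,1)$ satisfy $\xi_0=t\gamma+(1-t)\eta$ and $f(\xi_0)=\max\{f(\gamma),f(\eta)\}$, one has $\langle\gamma-\eta,\alpha\rangle=0$. A solution is an admissible $u$ at which the infimum is attained. *)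

(* Defs.v *)
From HB Require Import structures.
From mathcomp Require Import all_boot all_order all_algebra.
From mathcomp Require Import all_classical all_reals all_analysis.
From mathcomp Require Import measurable_realfun ess_sup_inf.
Set Implicit Arguments.
Unset Strict Implicit.
Unset Printing Implicit Defensive.
Import Order.TTheory GRing.Theory Num.Theory.
Import numFieldNormedType.Exports.
Local Open Scope classical_set_scope.
Local Open Scope ring_scope.

(* Borel sigma-algebra of R^n, generated by the open sets. *)
HB.instance Definition _ (R : realType) (n : nat) :=
  @isMeasurable.Build (sigma_display (@open 'rV[R]_n)) 'rV[R]_n
    <<s (@open 'rV[R]_n) >> (@sigma_algebra0 _ setT (@open 'rV[R]_n))
    (@sigma_algebraC _ (@open 'rV[R]_n))
    (@sigma_algebra_bigcup _ setT (@open 'rV[R]_n)).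

Section lebesgue_rV.
Context {R : realType}.

Lemma measurable_open_rV n (U : set 'rV[R]_n) : open U -> measurable U.
Proof. by move=> oU; exact: sub_sigma_algebra. Qed.

Lemma measurable_coord_rV n (i : 'I_n) :
  measurable_fun [set: 'rV[R]_n] (fun x => x ord0 i).
Proof.
apply: (measurability (@RGenOpens.G R) (RGenOpens.measurableE R)).
move=> _ [_ [a [b ->]] <-].
rewrite setTI; apply: measurable_open_rV.
apply: open_comp => [x _|]; first exact: coord_continuous.
exact: interval_open.
Qed.

Lemma open_bigcup_ball_rat n (U : set 'rV[R]_n) : open U ->
  U = \bigcup_(p in [set p : 'rV[rat]_n * nat |
        ball (map_mx ratr p.1 : 'rV[R]_n) p.2.+1%:R^-1 `<=` U])
        ball (map_mx ratr p.1 : 'rV[R]_n) p.2.+1%:R^-1.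
Proof.
move=> oU; apply/seteqP; split=> [x Ux|x [p /= pU]]; last exact: pU.
move: oU; rewrite openE => /(_ x Ux) /nbhs_ballP[e /= e0 eU].
have [k ke] : exists k, k.+1%:R^-1 < e / 2 :> R.
  exists (Num.trunc (e / 2)^-1).
  rewrite -ltf_pV2 ?posrE ?invr_gt0 ?divr_gt0// invrK.
  by rewrite truncnS_gt.
have k0 : 0 < k.+1%:R^-1 :> R by rewrite invr_gt0.
have q_ i : exists q : rat, `|ratr q - x ord0 i| < k.+1%:R^-1.
  have [|q] := @rat_in_itvoo R (x ord0 i - k.+1%:R^-1) (x ord0 i + k.+1%:R^-1).
    by rewrite ltrBlDr -addrA ltrDl addr_gt0.
  rewrite in_itv/= => /andP[q1 q2]; exists q.
  by rewrite ltr_distl q1 q2.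
have [q qx] := choice q_.
exists (\row_i q i, k) => /=; last first.
  by split=> // i j; rewrite (ord1 i) !mxE /ball/= qx.
move=> y [_ qy]; apply: eU; split => // i j.
have := qy i j; rewrite (ord1 i) !mxE /ball/= => qyj.
have -> : x ord0 j - y ord0 j
  = (x ord0 j - ratr (q j)) + (ratr (q j) - y ord0 j).
  by rewrite addrA subrK.
rewrite (le_lt_trans (ler_normD _ _))// [e]splitr ltrD//.
  by rewrite distrC (lt_trans (qx j)).
by rewrite (lt_trans qyj).
Qed.

Lemma measurable_fun_rV d (T : measurableType d) n (g : T -> 'rV[R]_n) :
  (forall i, measurable_fun setT (fun t => g t ord0 i)) ->
  measurable_fun setT g.
Proof.
move=> mg; apply: (measurability (@open 'rV[R]_n)) => //.
move=> _ [U oU <-]; rewrite setTI (open_bigcup_ball_rat oU) preimage_bigcup.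
rewrite bigcup_mkcond; apply: countable_bigcupT_measurable => // -[q k].
case: ifPn => _ //.
have -> : g @^-1` ball (map_mx ratr q : 'rV[R]_n) k.+1%:R^-1 =
    \bigcap_(i in [set: 'I_n]) (fun t => g t ord0 i) @^-1`
       ball (ratr (q ord0 i) : R) k.+1%:R^-1.
  apply/seteqP; split=> [t [_ qt] i _ /=|t qt].
    by have := qt ord0 i; rewrite mxE.
  by split=> [|i j]; rewrite ?invr_gt0// (ord1 i) mxE; exact: qt.
apply: fin_bigcap_measurable => [|i _]; first exact: finite_finset.
rewrite -[X in measurable X]setTI; apply: mg => //.
by rewrite ball_itv; exact: measurable_itv.
Qed.

Definition cons_rV n (p : R * 'rV[R]_n) : 'rV[R]_n.+1 := row_mx p.1%:M p.2.

Definition uncons_rV n (x : 'rV[R]_n.+1) : R * 'rV[R]_n :=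
  (x ord0 ord0, \row_i x ord0 (lift ord0 i)).

Lemma cons_rV0 n (p : R * 'rV[R]_n) : cons_rV p ord0 ord0 = p.1.
Proof.
rewrite /cons_rV; have -> : ord0 = lshift n (ord0 : 'I_1) by exact/val_inj.
by rewrite (@row_mxEl _ 1 1 n) mxE.
Qed.

Lemma cons_rVS n (p : R * 'rV[R]_n) i : cons_rV p ord0 (lift ord0 i) = p.2 ord0 i.
Proof.
rewrite /cons_rV; have -> : lift ord0 i = rshift 1 i by exact/val_inj.
by rewrite (@row_mxEr _ 1 1 n).
Qed.

Lemma uncons_rVK n : cancel (@uncons_rV n) (@cons_rV n).
Proof.
move=> x; apply/rowP => i; have [j ->|->] := unliftP ord0 i.
- by rewrite cons_rVS mxE.
- by rewrite cons_rV0.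
Qed.

Lemma cons_rVK n : cancel (@cons_rV n) (@uncons_rV n).
Proof.
move=> [a v]; rewrite /uncons_rV cons_rV0; congr pair.
by apply/rowP => i; rewrite mxE cons_rVS.
Qed.

Lemma measurable_cons_rV n : measurable_fun setT (@cons_rV n).
Proof.
apply: measurable_fun_rV => i; have [j ->|->] := unliftP ord0 i.
- under eq_fun do rewrite cons_rVS.
  apply: (@measurableT_comp _ _ _ _ _ _ (fun x : 'rV[R]_n => x ord0 j) _ snd).
    exact: measurable_coord_rV.
  exact: measurable_snd.
- under eq_fun do rewrite cons_rV0.
  exact: measurable_fst.
Qed.

Lemma measurable_uncons_rV n : measurable_fun setT (@uncons_rV n).
Proof.
apply: measurable_fun_pair; first exact: measurable_coord_rV.
apply: measurable_fun_rV => i; under eq_fun do rewrite mxE.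
exact: measurable_coord_rV.
Qed.

Section step.
Context {n : nat} (m : {sigma_finite_measure set 'rV[R]_n -> \bar R}).

Definition lebesgue_rV_step : set 'rV[R]_n.+1 -> \bar R :=
  pushforward (@lebesgue_measure R \x m)%E (@cons_rV n).

Let step0 : lebesgue_rV_step set0 = 0%E.
Proof. by rewrite /lebesgue_rV_step /pushforward preimage_set0 measure0. Qed.

Let step_ge0 A : (0 <= lebesgue_rV_step A)%E.
Proof. by rewrite /lebesgue_rV_step /pushforward; exact: measure_ge0. Qed.

Let step_sigma_additive : semi_sigma_additive lebesgue_rV_step.
Proof.
have mcons B : measurable B -> measurable (@cons_rV n @^-1` B).
  by move=> mB; rewrite -[X in measurable X]setTI; exact: measurable_cons_rV.
move=> F mF tF mUF; rewrite /lebesgue_rV_step /pushforward preimage_bigcup.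
apply: measure_semi_sigma_additive => [k||]; first exact: mcons.
- apply/trivIsetP => i j _ _ ij; rewrite -preimage_setI.
  by move/trivIsetP : tF => /(_ _ _ I I ij) ->; rewrite preimage_set0.
- by rewrite -preimage_bigcup; exact: mcons.
Qed.

HB.instance Definition _ := isMeasure.Build _ _ _ lebesgue_rV_step
  step0 step_ge0 step_sigma_additive.

Let step_sigma_finite : sigma_finite setT lebesgue_rV_step.
Proof.
have /sigma_finiteP[F [FT ndF Foo]] := sigma_finiteT (@lebesgue_measure R).
have /sigma_finiteP[G [GT ndG Goo]] := sigma_finiteT m.
exists (fun k => @uncons_rV n @^-1` (F k `*` G k)) => [|k].
  rewrite -preimage_bigcup [X in _ @^-1` X](_ : _ = setT) ?preimage_setT//.
  apply/seteqP; split=> // -[a v] _.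
  have [k1 _ Fa] : (\bigcup_k F k) a by rewrite -FT.
  have [k2 _ Gv] : (\bigcup_k G k) v by rewrite -GT.
  exists (maxn k1 k2) => //; split => /=.
  - by move: a Fa; exact/subsetPset/ndF/leq_maxl.
  - by move: v Gv; exact/subsetPset/ndG/leq_maxr.
have [mF Fk] := Foo k; have [mG Gk] := Goo k; split.
  rewrite -[X in measurable X]setTI; apply: measurable_uncons_rV => //.
  exact: measurableX.
rewrite /lebesgue_rV_step /pushforward -comp_preimage.
rewrite (_ : _ \o _ = id) ?preimage_id; last first.
  by apply/funext => p /=; rewrite cons_rVK.
by rewrite product_measure1E// lte_mul_pinfty// ge0_fin_numE.
Qed.

HB.instance Definition _ := Measure_isSigmaFinite.Build _ _ _ lebesgue_rV_step
  step_sigma_finite.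
End step.


(* n-dimensional Lebesgue measure, as an iterated product transported along
   R x R^n ~ R^(n+1); lebesgue_rV_box gives its value on boxes *)
Fixpoint lebesgue_rV n : {sigma_finite_measure set 'rV[R]_n -> \bar R} :=
  if n is n'.+1 then lebesgue_rV_step (lebesgue_rV n') else \d_(0 : 'rV[R]_0).

Lemma measurable_box_rV n (a b : 'rV[R]_n) :
  measurable [set x : 'rV[R]_n | forall i, x ord0 i \in `[a ord0 i, b ord0 i]].
Proof.
rewrite (_ : mkset _ = \bigcap_(i in [set: 'I_n])
    (fun x : 'rV[R]_n => x ord0 i) @^-1` `[a ord0 i, b ord0 i]); last first.
  by apply/seteqP; split=> x /= h i *; exact: h.
apply: fin_bigcap_measurable => [|i _]; first exact: finite_finset.
by rewrite -[X in measurable X]setTI; exact: measurable_coord_rV.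
Qed.

Lemma lebesgue_rV_box n (a b : 'rV[R]_n) : (forall i, a ord0 i <= b ord0 i) ->
  lebesgue_rV n [set x : 'rV[R]_n | forall i, x ord0 i \in `[a ord0 i, b ord0 i]] =
  (\prod_i (b ord0 i - a ord0 i))%:E.
Proof.
elim: n a b => [a b _|n IH a b ab].
  rewrite /= diracE big_ord0 mem_set//; by case.
pose tl (x : 'rV[R]_n.+1) : 'rV[R]_n := \row_i x ord0 (lift ord0 i).
have E : @cons_rV n @^-1`
      [set x : 'rV[R]_n.+1 | forall i, x ord0 i \in `[a ord0 i, b ord0 i]] =
    `[a ord0 ord0, b ord0 ord0] `*`
      [set x : 'rV[R]_n | forall i, x ord0 i \in `[tl a ord0 i, tl b ord0 i]].
  apply/seteqP; split=> -[t v] /=.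
  - move=> h; split=> [|i]; first by have := h ord0; rewrite cons_rV0.
    by have := h (lift ord0 i); rewrite cons_rVS !mxE.
  - move=> [h1 h2] i; have [j ->|->] := unliftP ord0 i.
    + by have := h2 j; rewrite cons_rVS !mxE.
    + by rewrite cons_rV0.
transitivity ((@lebesgue_measure R \x lebesgue_rV n)%E (@cons_rV n @^-1`
  [set x : 'rV[R]_n.+1 | forall i, x ord0 i \in `[a ord0 i, b ord0 i]])) => //.
rewrite E product_measure1E//; last exact: measurable_box_rV.
rewrite IH => [|i]; last by rewrite !mxE.
rewrite big_ord_recl EFinM; congr (_ * _)%E.
  rewrite [LHS](lebesgue_measure_itv `[a ord0 ord0, b ord0 ord0])/= lte_fin.
  by case: ltgtP (ab ord0) => // -> _; rewrite subrr.
by congr EFin; apply: eq_bigr => i _; rewrite !mxE.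
Qed.

End lebesgue_rV.

Section sobolev.
Context {R : realType} {n : nat}.
Implicit Types (Omega : set 'rV[R]_n) (u v phi : 'rV[R]_n -> R).

Local Notation mu := (@lebesgue_rV R n).

Definition dot_rV (x y : 'rV[R]_n) : R := \sum_i x ord0 i * y ord0 i.

Definition affine_rV (xi : 'rV[R]_n) (c : R) : 'rV[R]_n -> R :=
  fun x => dot_rV xi x + c.

Definition partial (i : 'I_n) phi : 'rV[R]_n -> R :=
  'D_(delta_mx ord0 i) phi.

(* phi is of class C^k on R^n, by iterated partial derivatives *)
Fixpoint Ck (k : nat) phi : Prop :=
  continuous phi /\
  if k is k'.+1 then
    forall i, (forall x, derivable phi x (delta_mx ord0 i)) /\
              Ck k' (partial i phi)
  else True.

(* C_0^oo(Omega), the functions being extended by 0 outside Omega *)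
Definition test_function Omega phi : Prop :=
  [/\ forall k, Ck k phi,
      compact (closure [set x | phi x != 0]) &
      closure [set x | phi x != 0] `<=` Omega].

(* L^p(Omega); only the values on Omega matter, whence the extension by 0 *)
Definition Lp_on Omega (p : \bar R) u : Prop := (u \_ Omega) \in Lfun mu p.

Definition loc_integrable Omega u : Prop :=
  forall K, compact K -> K `<=` Omega -> mu.-integrable K (EFin \o u).

Definition is_weak_partial Omega (i : 'I_n) u v : Prop :=
  [/\ loc_integrable Omega u, loc_integrable Omega v &
      forall phi, test_function Omega phi ->
        \int[mu]_(x in Omega) (u x * partial i phi x) =
        - \int[mu]_(x in Omega) (v x * phi x)].

(* A representative of the weak partial derivative, which is unique up to
   equality almost everywhere; junk value 0 if there is none *)
Definition weak_partial Omega (i : 'I_n) u : 'rV[R]_n -> R :=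
  xget (fun=> 0) [set v | is_weak_partial Omega i u v].

Definition weak_grad Omega u : 'rV[R]_n -> 'rV[R]_n :=
  fun x => \row_i weak_partial Omega i u x.

Definition W1 (p : \bar R) Omega u : Prop :=
  Lp_on Omega p u /\
  forall i, exists2 v, is_weak_partial Omega i u v & Lp_on Omega p v.

Definition W11_norm Omega u : \bar R :=
  ('N[mu]_1 [EFin \o (u \_ Omega)] +
   \sum_(i < n) 'N[mu]_1 [EFin \o (weak_partial Omega i u \_ Omega)])%E.

(* W^{1,oo}_0(Omega): closure of C_0^oo(Omega) in W^{1,1}(Omega), intersected
   with W^{1,oo}(Omega) *)
Definition W1oo_0 Omega u : Prop :=
  [/\ W1 +oo%E Omega u, W1 1%E Omega u &
      forall e : R, 0 < e ->
        exists2 phi, test_function Omega phi &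
          (W11_norm Omega (u \- phi)%R < e%:E)%E].

(* extending by -oo outside Omega leaves the essential supremum over Omega
   unchanged *)
Definition ess_sup_on Omega (g : 'rV[R]_n -> \bar R) : \bar R :=
  ess_sup mu (patch (fun=> -oo%E) Omega g).

Definition level_convex (f : 'rV[R]_n -> R) : Prop :=
  forall (xi eta : 'rV[R]_n) (t : R), 0 <= t <= 1 ->
    f (t *: xi + (1 - t) *: eta) <= Num.max (f xi) (f eta).

Definition strictly_level_convex_one_direction
    (f : 'rV[R]_n -> R) (xi0 : 'rV[R]_n) : Prop :=
  exists2 alpha : 'rV[R]_n, alpha != 0 &
    forall (gamma eta : 'rV[R]_n) (t : R), 0 < t < 1 ->
      xi0 = t *: gamma + (1 - t) *: eta ->
      f xi0 = Num.max (f gamma) (f eta) ->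
      dot_rV (gamma - eta) alpha = 0.

Definition admissible Omega (u0 : 'rV[R]_n -> R) : set ('rV[R]_n -> R) :=
  [set u | W1oo_0 Omega (u \- u0)].

Definition energy (f : 'rV[R]_n -> R) Omega u : \bar R :=
  ess_sup_on Omega (fun x => (f (weak_grad Omega u x))%:E).

Definition is_solution (f : 'rV[R]_n -> R) Omega (u0 u : 'rV[R]_n -> R) : Prop :=
  admissible Omega u0 u /\
  energy f Omega u = ereal_inf [set energy f Omega v | v in admissible Omega u0].

End sobolev.

(* Main.v *)
Require Import Defs.
From HB Require Import structures.
From mathcomp Require Import all_boot all_order all_algebra.
From mathcomp Require Import all_classical all_reals all_analysis.
From mathcomp Require Import measurable_realfun ess_sup_inf.
From mathcomp Require Import ring lra.
Import Order.TTheory GRing.Theory Num.Theory.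
Import numFieldNormedType.Exports.
Set Implicit Arguments.
Unset Strict Implicit.
Unset Printing Implicit Defensive.
Local Open Scope classical_set_scope.
Local Open Scope ring_scope.

(** Write w for the difference of an admissible function u and the affine
    function u0 = affine_rV xi0 c, so that the gradient of u is xi0 + Dw. As w
    is a limit in W^(1,1) of test functions, whose partial derivatives have
    integral zero, Dw has mean zero over Omega (W1oo_0_mean_grad).

    Lower bound. If f (xi0 + Dw) <= r almost everywhere, then Dw takes its
    values in the convex set L of all y with f (xi0 + y) <= r, and the mean of
    a function with values in a convex set belongs to this set, which gives
    f xi0 <= r. Sublevel sets of a level convex function need not be closed;
    hence mean0_in_convex works without closedness, by weak separation
    (convex_separation) and induction on the dimension.

    Uniqueness. Let f (xi0 + Dw) <= f xi0 almost everywhere and let alpha be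
    the direction of strict level convexity. If <alpha, Dw> were not zero
    almost everywhere, the means of Dw over the sets where it is positive and
    where it is nonpositive would be two points of L on a segment through 0
    that is not orthogonal to alpha, against strictness
    (mean0_extremal_direction). So w has derivative zero in the direction
    alpha. Testing the weak derivatives of w against <alpha, x> phi, where phi
    is a test function close to w, shows that the integral of w^2 is zero
    (W1oo_0_directional_eq0).

    Weak partial derivatives are chosen among representatives, and they are
    determined almost everywhere by the du Bois-Reymond lemma
    (loc_integrable_test_ae0). This lemma requires test functions that
    approximate indicators of boxes; they are products of functions
    exp (- c / t). *)

(** * Separation of a point from a convex set *)

Section dot.
Context {R : realType}.

Lemma dot_rVDr n (a x y : 'rV[R]_n) : dot_rV a (x + y) = dot_rV a x + dot_rV a y.
Proof.
by rewrite /dot_rV -big_split; apply: eq_bigr => i _; rewrite !mxE mulrDr.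
Qed.

Lemma dot_rVZr n (a x : 'rV[R]_n) t : dot_rV a (t *: x) = t * dot_rV a x.
Proof.
by rewrite /dot_rV mulr_sumr; apply: eq_bigr => i _; rewrite !mxE mulrCA.
Qed.

Lemma dot_rVC n (a x : 'rV[R]_n) : dot_rV a x = dot_rV x a.
Proof. by apply: eq_bigr => i _; rewrite mulrC. Qed.

Lemma dot_rV_cons n (s t : R) (a y : 'rV[R]_n) :
  dot_rV (cons_rV (s, a)) (cons_rV (t, y)) = s * t + dot_rV a y.
Proof.
rewrite /dot_rV big_ord_recl !cons_rV0; congr (_ + _).
by apply: eq_bigr => i _; rewrite !cons_rVS.
Qed.

Lemma cons_rVD n (s t : R) (x y : 'rV[R]_n) :
  cons_rV (s, x) + cons_rV (t, y) = cons_rV (s + t, x + y).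
Proof.
apply/rowP => i; rewrite mxE; have [j ->|->] := unliftP ord0 i.
  by rewrite !cons_rVS mxE.
by rewrite !cons_rV0.
Qed.

Lemma cons_rVZ n (s t : R) (x : 'rV[R]_n) :
  t *: cons_rV (s, x) = cons_rV (t * s, t *: x).
Proof.
apply/rowP => i; rewrite mxE; have [j ->|->] := unliftP ord0 i.
  by rewrite !cons_rVS mxE.
by rewrite !cons_rV0.
Qed.

Lemma cons_rV_eq0 n (s : R) (x : 'rV[R]_n) :
  (cons_rV (s, x) == 0) = (s == 0) && (x == 0).
Proof.
apply/eqP/andP => [e|[/eqP-> /eqP->]].
  have [] : (s, x) = (0, 0).
    rewrite -[LHS]cons_rVK e /uncons_rV mxE; congr pair.
    by apply/rowP => i; rewrite !mxE.
  by move=> -> ->; rewrite !eqxx.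
apply/rowP => i; rewrite [RHS]mxE; have [j ->|->] := unliftP ord0 i.
  by rewrite cons_rVS mxE.
by rewrite cons_rV0.
Qed.

(** The inequality is possibly not strict, and so the cone can be arbitrary.
    The induction extends a functional b from the hyperplane of
    vectors with first coordinate 0 by one coordinate c. This is possible
    unless the cone lies on one side of the hyperplane, in which case the first
    coordinate, up to sign, is itself the functional. Nonemptiness is what
    starts the induction: in dimension 0 the cone would contain 0. *)
Lemma cone_separation n (P : set 'rV[R]_n) :
  (forall x y, P x -> P y -> P (x + y)) ->
  (forall t x, 0 < t -> P x -> P (t *: x)) ->
  P !=set0 -> ~ P 0 ->
  exists2 a : 'rV[R]_n, a != 0 & forall y, P y -> 0 <= dot_rV a y.
Proof.
elim: n P => [|n IH] P PD PZ P_neq0 P0.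
  by case: P_neq0 => x; rewrite (thinmx0 x).
have consE (x : 'rV[R]_n.+1) : exists s y, x = cons_rV (s, y).
  by exists (uncons_rV x).1, (uncons_rV x).2; rewrite -[LHS]uncons_rVK.
have dot1 r s (y : 'rV[R]_n) : dot_rV (cons_rV (r, 0)) (cons_rV (s, y)) = r * s.
  rewrite dot_rV_cons [dot_rV _ _]big1 ?addr0// => i _.
  by rewrite mxE mul0r.
have [Pge0|] := pselect (forall s y, P (cons_rV (s, y)) -> 0 <= s).
  exists (cons_rV (1, 0)); first by rewrite cons_rV_eq0 oner_eq0.
  by move=> x; have [s [y ->]] := consE x => /Pge0 s0; rewrite dot1 mul1r.
move=> /existsNP[r0] /existsNP[z0] /not_implyP[Pz0 /negP]; rewrite -ltNge => r0_lt0.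
have [Ple0|] := pselect (forall s y, P (cons_rV (s, y)) -> s <= 0).
  exists (cons_rV (-1, 0)); first by rewrite cons_rV_eq0 oppr_eq0 oner_eq0.
  move=> x; have [s [y ->]] := consE x => /Ple0 s0.
  by rewrite dot1 mulN1r oppr_ge0.
move=> /existsNP[s0] /existsNP[y0] /not_implyP[Py0 /negP]; rewrite -ltNge => s0_gt0.
pose Q := [set y : 'rV[R]_n | P (cons_rV (0, y))].
pose U := [set y : 'rV[R]_n | P (cons_rV (1, y))].
pose V := [set y : 'rV[R]_n | P (cons_rV (-1, y))].
have scale1 s y : 0 < s -> P (cons_rV (s, y)) -> U (s^-1 *: y).
  move=> s_gt0 /(PZ s^-1); rewrite cons_rVZ mulVf ?gt_eqF//; apply.
  by rewrite invr_gt0.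
have scaleN1 s y : s < 0 -> P (cons_rV (s, y)) -> V ((- s)^-1 *: y).
  move=> s_lt0 /(PZ (- s)^-1); rewrite cons_rVZ {2}invrN mulNr mulVf ?lt_eqF//.
  by apply; rewrite invr_gt0 oppr_gt0.
have UV y z : U y -> V z -> Q (y + z).
  by move=> Uy Vz; have := PD _ _ Uy Vz; rewrite cons_rVD subrr.
have Uy0 := scale1 _ _ s0_gt0 Py0; have Vz0 := scaleN1 _ _ r0_lt0 Pz0.
have [||||b b0 bQ] := IH Q.
- by move=> x y Qx Qy; have := PD _ _ Qx Qy; rewrite cons_rVD addr0.
- by move=> t x t0 Qx; have := PZ _ _ t0 Qx; rewrite cons_rVZ mulr0.
- by exists (s0^-1 *: y0 + (- r0)^-1 *: z0); exact: UV.
- rewrite /Q /= => Q0; apply: P0; move: Q0; congr P.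
  by apply/eqP; rewrite cons_rV_eq0 !eqxx.
have le_UV y z : U y -> V z -> - dot_rV b y <= dot_rV b z.
  by move=> Uy Vz; rewrite -subr_ge0 opprK addrC -dot_rVDr; apply/bQ/UV.
(* c has to be at least - <b, y> for y on one side of the hyperplane and at
   most <b, z> for z on the other; adding (1, y) and (-1, z) gives a point of
   the hyperplane, where b is nonnegative, so these bounds are compatible *)
pose c := sup [set - dot_rV b y | y in U].
have c_ge y : U y -> - dot_rV b y <= c.
  move=> Uy; apply: ub_le_sup; last by exists y.
  by exists (dot_rV b ((- r0)^-1 *: z0)) => _ [x Ux <-]; exact: le_UV.
have c_le z : V z -> c <= dot_rV b z.
  move=> Vz; apply: ge_sup; first by exists (- dot_rV b (s0^-1 *: y0)), (s0^-1 *: y0).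
  by move=> _ [x Ux <-]; exact: le_UV.
exists (cons_rV (c, b)); first by rewrite cons_rV_eq0 (negbTE b0) andbF.
move=> x; have [s [y ->]] := consE x => Py; rewrite dot_rV_cons.
have [s_lt0|s_gt0|s_eq0] := ltgtP s 0.
- have := c_le _ (scaleN1 _ _ s_lt0 Py); rewrite dot_rVZr ler_pdivlMl ?oppr_gt0//.
  lra.
- have := c_ge _ (scale1 _ _ s_gt0 Py).
  rewrite dot_rVZr -mulrN ler_pdivrMl//.
  lra.
- by rewrite s_eq0 mulr0 add0r; apply: bQ; rewrite /Q/= -s_eq0.
Qed.

(** The cone generated by L does not contain 0 either. *)
Lemma convex_separation n (L : set 'rV[R]_n) :
  (forall x y t, 0 <= t <= 1 -> L x -> L y -> L (t *: x + (1 - t) *: y)) ->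
  L !=set0 -> ~ L 0 ->
  exists2 a : 'rV[R]_n, a != 0 & forall y, L y -> 0 <= dot_rV a y.
Proof.
move=> Lconv [x0 Lx0] L0.
have [||||a a0 aP] := @cone_separation n [set x | exists2 t, 0 < t & L (t *: x)].
- move=> x y [s s0 Lx] [t t0 Ly].
  have st0 : 0 < s + t by rewrite addr_gt0.
  exists (s * t / (s + t)); first by rewrite divr_gt0// mulr_gt0.
  (* s t (x + y) / (s + t) is the combination of s x and t y with weights
     t / (s + t) and s / (s + t) *)
  have := Lconv _ _ (t / (s + t)) _ Lx Ly.
  have -> : 1 - t / (s + t) = s / (s + t) by field; rewrite gt_eqF.
  rewrite !scalerA scalerDr mulrAC (mulrC t s) (mulrAC s) ; apply.
  apply/andP; split; first by rewrite divr_ge0 ?(ltW st0) ?(ltW t0).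
  by rewrite ler_pdivrMr// mul1r lerDr ltW.
- move=> t x t0 [s s0 Lx]; exists (s / t); first by rewrite divr_gt0.
  by rewrite scalerA divfK ?gt_eqF.
- by exists x0, 1; rewrite ?scale1r.
- by move=> [t _]; rewrite scaler0.
by exists a => // y Ly; apply: aP; exists 1; rewrite ?scale1r.
Qed.

End dot.

(** * Means of functions with values in a convex set *)

Section integral_tools.
Context d (T : measurableType d) {R : realType} (mu : {measure set T -> \bar R}).
Variables (D : set T) (mD : measurable D).

Lemma ae_exists (P : T -> Prop) :
  (0 < mu D)%E -> {ae mu, forall x, D x -> P x} -> exists2 x, D x & P x.
Proof.
move=> muD aeP; apply: contrapT => noP.
have : mu.-negligible D.
  apply: negligibleS aeP => x Dx /= /(_ Dx) Px.
  by apply: noP; exists x.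
by move/(negligibleP mu mD) => D0; rewrite D0 ltxx in muD.
Qed.

Lemma integral_EFin (f : T -> R) : mu.-integrable D (EFin \o f) ->
  (\int[mu]_(x in D) (f x)%:E)%E = (\int[mu]_(x in D) f x)%:E.
Proof. by move=> intf; rewrite [RHS]fineK//; exact: integrable_fin_num. Qed.

Lemma Rintegral_eq0_ae (f : T -> R) : mu.-integrable D (EFin \o f) ->
  {ae mu, forall x, D x -> 0 <= f x} -> \int[mu]_(x in D) f x = 0 ->
  {ae mu, forall x, D x -> f x = 0}.
Proof.
move=> intf f0 If0.
have mf : measurable_fun D (EFin \o f) := measurable_int mu intf.
have : (\int[mu]_(x in D) `|(EFin \o f) x| = 0)%E.
  rewrite -[RHS](_ : (\int[mu]_(x in D) (EFin \o f) x)%E = 0%E); last first.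
    by rewrite integral_EFin// If0.
  apply: ae_eq_integral => //; first exact: measurableT_comp.
  by apply: filterS f0 => x h Dx /=; rewrite ger0_norm// h.
move/(ae_eq_integral_abs mu mD mf); apply: filterS => x h Dx.
by have [] := h Dx.
Qed.

Lemma integrable_lin n (c : 'I_n -> R) (h : 'I_n -> T -> R) :
  (forall i, mu.-integrable D (EFin \o h i)) ->
  mu.-integrable D (EFin \o (fun x => \sum_i c i * h i x)).
Proof.
move=> inth; apply: (eq_integrable mD (fun x => \sum_i ((c i)%:E * (h i x)%:E)%E)%E).
  by move=> x _; rewrite /= -sumEFin; apply: eq_bigr => i _; rewrite EFinM.
by apply: integrable_sum => // i _; exact: (integrableZl mD (c i) (inth i)).
Qed.

Lemma Rintegral_lin n (c : 'I_n -> R) (h : 'I_n -> T -> R) :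
  (forall i, mu.-integrable D (EFin \o h i)) ->
  \int[mu]_(x in D) (\sum_i c i * h i x) = \sum_i c i * \int[mu]_(x in D) h i x.
Proof.
move=> inth; rewrite {1}/Rintegral.
under eq_integral do rewrite -sumEFin.
rewrite integral_sum//; last first.
  by move=> i; exact: (integrableZl mD (c i) (inth i)).
rewrite -sum_fine; last first.
  move=> i _; apply: integrable_fin_num => //.
  exact: (integrableZl mD (c i) (inth i)).
by apply: eq_bigr => i _; rewrite -RintegralZl.
Qed.

(** If 0 were not in L, a functional separating it from L would be nonnegative
    along h with integral zero, hence zero almost everywhere. So h would stay
    in a hyperplane, and the dimension drops. *)
Lemma mean0_in_convex n (h : T -> 'rV[R]_n) (L : set 'rV[R]_n) :
  (0 < mu D)%E ->
  (forall i, mu.-integrable D (EFin \o (fun x => h x ord0 i))) ->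
  (forall i, \int[mu]_(x in D) h x ord0 i = 0) ->
  (forall x y t, 0 <= t <= 1 -> L x -> L y -> L (t *: x + (1 - t) *: y)) ->
  {ae mu, forall x, D x -> L (h x)} -> L 0.
Proof.
move=> muD; elim/ltn_ind: n h L => n IH h L inth h0 Lconv Lh.
apply: contrapT => L0.
have [x0 Dx0 Lx0] := ae_exists muD Lh.
have [|a a0 aL] := convex_separation Lconv _ L0; first by exists (h x0).
have ah0 : {ae mu, forall x, D x -> dot_rV a (h x) = 0}.
  apply: Rintegral_eq0_ae; first exact: integrable_lin.
    by apply: filterS Lh => x hx Dx; apply/aL/hx.
  by rewrite Rintegral_lin// big1// => i _; rewrite h0 mulr0.
(* the rows of B are a basis of the hyperplane orthogonal to a *)
pose B := row_base (kermx a^T).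
have BE x : dot_rV a x = 0 -> x *m pinvmx B *m B = x.
  move=> ax0; apply: mulmxKpV; rewrite eq_row_base sub_kermx.
  apply/eqP/matrixP => i j; rewrite !ord1 !mxE -[RHS]ax0 dot_rVC.
  by apply: eq_bigr => k _; rewrite mxE.
have rn : (\rank (kermx a^T) < n)%N.
  rewrite mxrank_ker mxrank_tr rank_rV a0 subn1 ltn_predL.
  by case: (n) a a0 {aL ah0 B BE} => // a; rewrite (thinmx0 a) eqxx.
have intB i : mu.-integrable D (EFin \o (fun x => (h x *m pinvmx B) ord0 i)).
  rewrite (_ : EFin \o _ = EFin \o (fun x => \sum_j pinvmx B j i * h x ord0 j)).
    exact: integrable_lin.
  by apply/funext => x /=; rewrite mxE; congr EFin; apply: eq_bigr => j _; rewrite mulrC.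
suff : [set y | L (y *m B)] 0 by rewrite /= mul0mx.
apply: (IH _ rn (fun x => h x *m pinvmx B)) => // [i|x y t t01 Lx Ly|].
- transitivity (\int[mu]_(x in D) \sum_j pinvmx B j i * h x ord0 j).
    by apply: eq_Rintegral => x _; rewrite mxE; apply: eq_bigr => j _; rewrite mulrC.
  by rewrite Rintegral_lin// big1// => j _; rewrite h0 mulr0.
- by rewrite /= mulmxDl -!scalemxAl; exact: Lconv.
- by apply: filterS2 ah0 Lh => x /= ahx Lhx Dx; rewrite BE ?ahx//; exact: Lhx.
Qed.

End integral_tools.

(** * Calculus of functions of class C^k *)

Section derivatives.
Context {R : realType}.

(** A directional derivative depends only on the restriction to a line; this
    moves it between functions defined on different spaces. *)
Lemma is_derive_path (V W : normedModType R) (F : V -> R) (G : W -> R)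
    (x v : V) (y w : W) (l : R) :
  (forall h : R, G (h *: w + y) = F (h *: v + x)) ->
  is_derive x v F l -> is_derive y w G l.
Proof.
move=> GF [dF <-].
have E : (fun h : R => h^-1 *: ((G \o shift y) (h *: w) - G y)) =
         (fun h : R => h^-1 *: ((F \o shift x) (h *: v) - F x)).
  apply/funext => h /=; rewrite GF; congr (_ *: (_ - _)).
  by have := GF 0; rewrite !scale0r !add0r.
by apply: DeriveDef; rewrite ?/derivable ?/derive E.
Qed.

End derivatives.

Section Ck.
Context {R : realType} {n : nat}.
Implicit Types (phi psi : 'rV[R]_n -> R) (v x : 'rV[R]_n).

Lemma continuous_fctD (T : topologicalType) (g h : T -> R) :
  continuous g -> continuous h -> continuous (fun y => g y + h y).
Proof. by move=> cg ch y; exact: (continuousD (cg y) (ch y)). Qed.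

Lemma continuous_fctM (T : topologicalType) (g h : T -> R) :
  continuous g -> continuous h -> continuous (fun y => g y * h y).
Proof. by move=> cg ch y; exact: (continuousM (cg y) (ch y)). Qed.

Lemma dot_rV_lin (b x v : 'rV[R]_n) t :
  dot_rV b (t *: v + x) = t * dot_rV b v + dot_rV b x.
Proof. by rewrite dot_rVDr dot_rVZr. Qed.

Lemma is_derive_affine_comp (g : R -> R) (b : 'rV[R]_n) (a dg : R) x v :
  is_derive (affine_rV b a x) 1 g dg ->
  is_derive x v (g \o affine_rV b a) (dot_rV b v * dg).
Proof.
move=> gd; pose line (t : R) := t * dot_rV b v + affine_rV b a x.
apply: (@is_derive_path _ _ _ (g \o line) _ 0 1) => [t|].
  have -> : t *: (1 : R) + 0 = t by rewrite addr0 [_ *: _]mulr1.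
  by rewrite /= /line /affine_rV dot_rV_lin addrA.
rewrite mulrC; apply: is_derive1_comp; first by rewrite /line mul0r add0r.
apply: is_derive_eq.
by rewrite /= addr0 scaler0 add0r [_ *: _]mulr1.
Qed.

Lemma continuous_affine_rV (b : 'rV[R]_n) (a : R) : continuous (affine_rV b a).
Proof.
have cdot : continuous (dot_rV b).
  apply: (@continuous_big _ _ +%R 0) => [|i _ x]; first exact: add_continuous.
  by apply: continuousM; [exact: cst_continuous|exact: coord_continuous].
by move=> x; apply: continuousD; [exact: cdot|exact: cst_continuous].
Qed.

Lemma Ck_continuous k phi : Ck k phi -> continuous phi.
Proof. by case: k => [[]|k []]. Qed.

Lemma CkW k phi : Ck k.+1 phi -> Ck k phi.
Proof.
elim: k phi => [|k IH] phi [cphi dphi]; first by split.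
by split=> // i; have [d1 d2] := dphi i; split => //; exact: IH.
Qed.

Lemma Ck_derive k phi i x :
  Ck k.+1 phi -> is_derive x (delta_mx ord0 i) phi (partial i phi x).
Proof. by move=> [_ /(_ i)[/(_ x) d _]]; apply: DeriveDef. Qed.

Lemma Ck_partial k phi i : Ck k.+1 phi -> Ck k (partial i phi).
Proof. by case=> _ /(_ i)[]. Qed.

Lemma CkP k phi (dphi : 'I_n -> 'rV[R]_n -> R) : continuous phi ->
  (forall i x, is_derive x (delta_mx ord0 i) phi (dphi i x)) ->
  (forall i, Ck k (dphi i)) -> Ck k.+1 phi.
Proof.
move=> cphi dphiE Cdphi; split=> // i; split.
  by move=> x; have [] := dphiE i x.
rewrite (_ : partial i phi = dphi i)//; apply/funext => x.
by have [] := dphiE i x.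
Qed.

Lemma partialE phi i x l :
  is_derive x (delta_mx ord0 i) phi l -> partial i phi x = l.
Proof. by case. Qed.

Lemma Ck_cst k (r : R) : Ck k (fun _ : 'rV[R]_n => r).
Proof.
elim: k r => [|k IH] r; first by split=> // x; exact: cst_continuous.
by apply: (@CkP _ _ (fun _ _ => 0)) => [x|i]; [exact: cst_continuous|exact: IH].
Qed.

Lemma CkD k phi psi : Ck k phi -> Ck k psi -> Ck k (fun x => phi x + psi x).
Proof.
elim: k phi psi => [|k IH] phi psi C1 C2.
  by split=> //; exact: continuous_fctD C1.1 C2.1.
apply: (@CkP _ _ (fun i x => partial i phi x + partial i psi x)) => [|i x|i].
- exact: continuous_fctD C1.1 C2.1.
- exact: (is_deriveD (Ck_derive i x C1) (Ck_derive i x C2)).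
- by apply: IH; exact: Ck_partial.
Qed.

Lemma CkM k phi psi : Ck k phi -> Ck k psi -> Ck k (fun x => phi x * psi x).
Proof.
elim: k phi psi => [|k IH] phi psi C1 C2.
  by split=> //; exact: continuous_fctM C1.1 C2.1.
apply: (@CkP _ _ (fun i x => phi x * partial i psi x + psi x * partial i phi x))
  => [|i x|i].
- exact: continuous_fctM C1.1 C2.1.
- exact: (is_deriveM (Ck_derive i x C1) (Ck_derive i x C2)).
- by apply: CkD; apply: IH; [exact: CkW|exact: Ck_partial|exact: CkW|exact: Ck_partial].
Qed.

Lemma Ck_prod k I (r : seq I) (F : I -> 'rV[R]_n -> R) :
  (forall i, Ck k (F i)) -> Ck k (fun x => \prod_(i <- r) F i x).
Proof.
move=> CF; elim: r => [|i r IH].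
  by under eq_fun do rewrite big_nil; exact: Ck_cst.
by under eq_fun do rewrite big_cons; exact: CkM.
Qed.

(** A sequence g of functions of one variable, each the derivative of the
    previous one, encodes a smooth function together with its derivatives. *)
Lemma Ck_affine_comp k (g : nat -> R -> R) (b : 'rV[R]_n) (a : R) m :
  (forall j t, is_derive t (1 : R) (g j) (g j.+1 t)) ->
  Ck k (g m \o affine_rV b a).
Proof.
move=> dg; have cg j : continuous (g j).
  by move=> t; apply/differentiable_continuous/derivable1_diffP; case: (dg j t).
have cgb j : continuous (g j \o affine_rV b a).
  by move=> x; apply: continuous_comp; [exact: continuous_affine_rV|exact: cg].
elim: k m => [|k IH] m; first by split=> //; exact: cgb.
apply: (@CkP _ _ (fun i x => dot_rV b (delta_mx ord0 i) *
  (g m.+1 \o affine_rV b a) x)) => [|i x|i].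
- exact: cgb.
- exact: is_derive_affine_comp.
- by apply: CkM; [exact: Ck_cst|exact: IH].
Qed.

Lemma Ck_affine k (b : 'rV[R]_n) (a : R) : Ck k (affine_rV b a).
Proof.
apply: (@Ck_affine_comp k (fun j => if j is j'.+1 then cst (j' == 0%N)%:R else id) b a 0).
by case=> [|j] t; [exact: is_derive_id|exact: is_derive_cst].
Qed.

Lemma dot_rV_delta (b : 'rV[R]_n) i : dot_rV b (delta_mx ord0 i) = b ord0 i.
Proof.
rewrite /dot_rV (bigD1 i)//= mxE !eqxx mulr1 big1 ?addr0// => j ji.
by rewrite mxE (negbTE ji) mulr0.
Qed.

Lemma partial_affine (b : 'rV[R]_n) a i x : partial i (affine_rV b a) x = b ord0 i.
Proof.
apply: partialE; rewrite -[b ord0 i]mulr1 -dot_rV_delta.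
exact: (@is_derive_affine_comp id).
Qed.

Lemma partialM phi psi i x : Ck 1 phi -> Ck 1 psi ->
  partial i (fun x => phi x * psi x) x =
  phi x * partial i psi x + psi x * partial i phi x.
Proof.
by move=> C1 C2; apply: partialE; exact: (is_deriveM (Ck_derive i x C1) (Ck_derive i x C2)).
Qed.

End Ck.

Section bump.
Context {R : realType}.
Implicit Types (c t : R) (p : {poly R}).

(** The polynomial in 1 / t makes this family, which contains the flat function
    exp (- c / t) for t > 0, closed under differentiation. *)
Definition expV c p t : R := if 0 < t then p.[t^-1] * expR (- (c / t)) else 0.

(** Boundedness for every p, applied to p * X^2, also gives the decay at 0 that
    makes the functions differentiable there. *)
Lemma expV_le c p : 0 < c -> exists M, forall t, 0 < t -> `|expV c p t| <= M.
Proof.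
move=> c0.
(* with s = 1 / t, the inequality y <= exp y at y = c s / m, raised to the
   power m, bounds s ^ m by a multiple of exp (c s) *)
have Xbound m : exists M, forall s : R, 0 < s -> s ^+ m * expR (- (c * s)) <= M.
  case: m => [|m].
    exists 1 => s s0; rewrite expr0 mul1r expR_le1 oppr_le0.
    by rewrite mulr_ge0// ltW.
  exists ((m.+1%:R / c) ^+ m.+1) => s s0; rewrite expRN.
  rewrite ler_pdivrMr ?expR_gt0//.
  have -> : c * s = m.+1%:R * (c * s / m.+1%:R) by rewrite [RHS]mulrC divfK// pnatr_eq0.
  rewrite expRM_natl -exprMn lerXn2r ?nnegrE ?(ltW s0)//.
    by rewrite mulr_ge0 ?expR_ge0// divr_ge0// ltW.
  have {1}-> : s = m.+1%:R / c * (c * s / m.+1%:R).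
    by field; rewrite (gt_eqF c0) /= andbT nat1r pnatr_eq0.
  rewrite ler_wpM2l ?divr_ge0 ?(ltW c0)//.
  by rewrite (le_trans _ (expR_ge1Dx _))// lerDr.
have : exists M, forall s : R, 0 < s -> `|p.[s] * expR (- (c * s))| <= M.
  elim/poly_ind: p => [|p a _].
    by exists 0 => s s0; rewrite horner0 mul0r normr0.
  set q := p * 'X + a%:P.
  have [M MP] := choice Xbound.
  exists (\sum_(i < size q) `|q`_i| * M i) => s s0.
  rewrite horner_coef mulr_suml (le_trans (ler_norm_sum _ _ _))//.
  apply: ler_sum => i _; rewrite -mulrA normrM ler_wpM2l//.
  by rewrite ger0_norm ?MP// mulr_ge0 ?expR_ge0// exprn_ge0// ltW.
move=> [M MP]; exists M => t t0; rewrite /expV t0; apply: MP.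
by rewrite invr_gt0.
Qed.

Lemma is_derive_expV c p t : 0 < c ->
  is_derive t (1 : R) (expV c p) (expV c ((c *: p - p^`()) * 'X^2) t).
Proof.
move=> c0; have scE (a b : R) : a *: (b : R^o) = a * b by [].
have [t0|t0|t0] := ltgtP t 0.
- have -> : expV c ((c *: p - p^`()) * 'X^2) t = 0 by rewrite /expV ltNge ltW.
  apply: (@near_eq_is_derive _ _ _ (cst 0)).
  near=> s; rewrite /expV ltNge ltW//.
  by near: s; exact: lt_nbhsl.
- have dV : is_derive t (1 : R) (fun s : R => s^-1) (- t ^- 2).
    apply: is_derive_eq; first by apply: is_deriveV; rewrite ?gt_eqF//.
    by rewrite [_ *: _]mulr1.
  have dp : is_derive t (1 : R) (fun s => p.[s^-1]) (p^`().[t^-1] * (- t ^- 2)).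
    exact: (@is_derive1_comp _ (horner p)).
  have de : is_derive t (1 : R) (fun s => expR (- (c * s^-1)))
      (expR (- (c * t^-1)) * (- (c * (- t ^- 2)))).
    apply: (@is_derive1_comp _ expR (fun s => - (c * s^-1))).
  have dpe := is_deriveM dp de.
  have := near_eq_is_derive _ dpe; move=> /(_ (expV c p)) H.
  apply: is_derive_eq; first apply: H.
    near=> s; rewrite /expV ifT//.
    by near: s; exact: lt_nbhsr.
  rewrite /expV t0 !scE !hornerE /=; by field; rewrite gt_eqF.
- have -> : expV c ((c *: p - p^`()) * 'X^2) t = 0 by rewrite /expV t0 ltxx.
  rewrite {}t0.
  have expV0 : expV c p 0 = 0 by rewrite /expV ltxx.
  have expVX (h : R) : 0 < h -> h^-1 * expV c p h = h * expV c (p * 'X^2) h.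
    move=> h0; rewrite /expV h0 hornerM hornerXn.
    by field; rewrite gt_eqF.
  have [M MP] := expV_le (p * 'X^2) c0.
  have M1 : 0 < `|M| + 1 by rewrite ltr_pwDr.
  have cv : (fun h : R => h^-1 *: ((expV c p \o shift 0) (h *: 1) - expV c p 0))
      @ 0^' --> (0 : R).
    apply/cvgr0Pnorm_le => e e0; near=> h.
    rewrite /= addr0 [h *: 1]mulr1 expV0 subr0 scE.
    have [h0|h0] := ltP 0 h; last first.
      by rewrite /expV ltNge h0/= mulr0 normr0 ltW.
    rewrite expVX//.
    rewrite normrM (gtr0_norm h0) (le_trans (ler_wpM2l (ltW h0) (MP _ h0)))//.
    rewrite (@le_trans _ _ (h * (`|M| + 1)))//.
      by rewrite ler_wpM2l ?(ltW h0)// (le_trans (ler_norm M))// lerDl.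
    rewrite -ler_pdivlMr//; near: h.
    apply: nbhs_dnbhs; apply: filterS (nbhs0_le (divr_gt0 e0 M1)) => s.
    exact: le_trans (ler_norm _).
  by apply: DeriveDef; [apply/cvg_ex; exists 0|exact: cvg_lim cv].
Unshelve. all: by end_near. Qed.

Lemma expV1_gt0 c t : 0 < t -> expV c 1 t = expR (- (c / t)).
Proof. by move=> t0; rewrite /expV t0 hornerC mul1r. Qed.

Lemma Ck_expV n k c (b : 'rV[R]_n) (a : R) p : 0 < c ->
  Ck k (fun x => expV c p (affine_rV b a x)).
Proof.
move=> c0.
apply: (@Ck_affine_comp _ _ _
  (fun j => expV c (iter j (fun q => (c *: q - q^`()) * 'X^2) p)) b a 0).
by move=> j t; exact: is_derive_expV.
Qed.

End bump.

(** * Boxes and bump functions *)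

Section pi_system_ae.
Context d (T : measurableType d) {R : realType} (mu : {measure set T -> \bar R}).

(** By Dynkin's theorem, the integral of f vanishes over all measurable subsets
    of Q, in particular over those where f has a constant sign. *)
Lemma integral_pi_system_ae0 (G : set (set T)) (Q : set T) (f : T -> R) :
  @measurable d T `<=` <<s G >> -> G `<=` @measurable d T -> setI_closed G ->
  measurable Q -> mu.-integrable Q (EFin \o f) ->
  (\int[mu]_(x in Q) (f x)%:E = 0)%E ->
  (forall A, G A -> \int[mu]_(x in Q `&` A) (f x)%:E = 0)%E ->
  {ae mu, forall x, Q x -> f x = 0}.
Proof.
move=> mG Gm GI mQ intf IQ IG.
pose H := [set A | measurable A /\ (\int[mu]_(x in Q `&` A) (f x)%:E = 0)%E].
have intS A : measurable A -> mu.-integrable (Q `&` A) (EFin \o f).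
  by move=> mA; apply: integrableS intf => //; exact: measurableI.
have Hdynkin : dynkin H.
  split=> [|A [mA IA]|F tF HF].
  - by split; rewrite ?setIT.
  - split; first exact: measurableC.
    have := IQ; rewrite -{1}[Q]setIT -(setUv A) setIUr integral_setU//=.
    + by rewrite IA add0e.
    + exact: measurableI.
    + by apply: measurableI => //; exact: measurableC.
    + by rewrite -setIUr setUv setIT; exact: measurable_int intf.
    + by apply/disj_setPS => x [[_ Ax] [_ nAx]].
  - have mF k : measurable (F k) by have [] := HF k.
    have mUF : measurable (\bigcup_k F k) by exact: bigcupT_measurable.
    split=> //; rewrite setI_bigcupr (@integral_bigcup _ _ _ _ _ (EFin \o f)).
    + by rewrite eseries0// => k _ _; have [] := HF k.
    + by apply/trivIsetP => i j _ _ ij; rewrite setIACA setIid;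
        move/trivIsetP : tF => /(_ i j I I ij) ->; rewrite setI0.
    + by move=> k; exact: measurableI.
    + by rewrite -setI_bigcupr; exact: intS.
have HG : @measurable d T `<=` H.
  apply: subset_trans mG _; apply: lambda_system_subset => //.
  - exact/dynkin_lambda_system.
  - by move=> A GA; split; [exact: Gm|exact: IG].
have : ae_eq mu Q (EFin \o f) (cst 0%E).
  apply: integral_ae_eq => // E EQ mE; rewrite integral0.
  by have [_] := HG _ mE; rewrite setIidr.
by apply: filterS => x h /h [].
Qed.

End pi_system_ae.

Section boxes.
Context {R : realType} {n : nat}.
Implicit Types (a b x : 'rV[R]_n) (U : set 'rV[R]_n) (phi : 'rV[R]_n -> R).

Definition obox a b := [set x : 'rV[R]_n | forall i, a ord0 i < x ord0 i < b ord0 i].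

Definition cbox a b :=
  [set x : 'rV[R]_n | forall i, x ord0 i \in `[a ord0 i, b ord0 i]].

Lemma obox_sub_cbox a b : obox a b `<=` cbox a b.
Proof.
by move=> x xab i; rewrite in_itv/=; have /andP[/ltW-> /ltW->] := xab i.
Qed.

Lemma measurable_obox a b : measurable (obox a b).
Proof.
rewrite (_ : obox a b = \bigcap_(i in [set: 'I_n])
    (fun x : 'rV[R]_n => x ord0 i) @^-1` `]a ord0 i, b ord0 i[); last first.
  apply/seteqP; split=> x /= h i => [_|]; first by rewrite /= in_itv/=; exact: h.
  by have := h i I; rewrite /= in_itv.
apply: fin_bigcap_measurable => [|i _]; first exact: finite_finset.
by rewrite -[X in measurable X]setTI; exact: measurable_coord_rV.
Qed.

Lemma compact_cbox a b : compact (cbox a b).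
Proof.
apply: (@rV_compact _ _ (fun i => `[a ord0 i, b ord0 i]%classic)) => i.
exact: segment_compact.
Qed.

Lemma closed_cbox a b : closed (cbox a b).
Proof. by apply: compact_closed; [exact: norm_hausdorff|exact: compact_cbox]. Qed.

Lemma oboxI a b a' b' : obox a b `&` obox a' b' =
  obox (\row_i Num.max (a ord0 i) (a' ord0 i)) (\row_i Num.min (b ord0 i) (b' ord0 i)).
Proof.
apply/seteqP; split=> x.
  move=> [h h'] i; have := h i; have := h' i.
  by rewrite !mxE gt_max lt_min => /andP[-> ->] /andP[-> ->].
by move=> h; split=> i; have := h i;
  rewrite !mxE gt_max lt_min => /andP[/andP[h1 h2] /andP[h3 h4]]; apply/andP.
Qed.

Lemma cubeP (M : R) x :
  (forall i, ~ M < `|x ord0 i|) -> cbox (const_mx (- M)) (const_mx M) x.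
Proof.
move=> xM i; rewrite in_itv/= !mxE -ler_norml.
by have /negP := xM i; rewrite -leNgt.
Qed.

Lemma measurable_closed_rV (A : set 'rV[R]_n) : closed A -> measurable A.
Proof.
move=> cA; rewrite -[A]setCK; apply: measurableC; apply: measurable_open_rV.
exact: closed_openC.
Qed.

Lemma bounded_in_cube (A : set 'rV[R]_n) : bounded_set A ->
  exists2 M : R, 0 < M & A `<=` cbox (const_mx (- M)) (const_mx M).
Proof.
move=> [B [_ BP]]; pose M := `|B| + 1.
have BM : B < M by rewrite (le_lt_trans (ler_norm B))// ltrDl.
exists M => [|x Ax]; first by rewrite ltr_pwDr.
apply: cubeP => i; apply/negP; rewrite -leNgt; apply: le_trans (BP _ BM _ Ax).
rewrite -[`|x|]/(mx_norm x) mx_normrE.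
exact: (le_bigmax _ (fun ij : 'I_1 * 'I_n => `|x ij.1 ij.2|) (ord0, i)).
Qed.

Lemma bounded_measure_lty (A : set 'rV[R]_n) : measurable A -> bounded_set A ->
  (lebesgue_rV n A < +oo)%E.
Proof.
move=> mA /bounded_in_cube[M M0 AM].
have muK := @lebesgue_rV_box R n (const_mx (- M)) (const_mx M).
apply: (@le_lt_trans _ _ (lebesgue_rV n (cbox (const_mx (- M)) (const_mx M)))).
  by apply: le_measure; rewrite ?inE//; exact: measurable_box_rV.
rewrite [X in (X < _)%E]muK ?ltry// => i.
by rewrite !mxE; lra.
Qed.

Lemma continuous_compact_bounded (K : set 'rV[R]_n) phi : compact K ->
  continuous phi -> [bounded phi x | x in K].
Proof.
move=> cK cphi; have : compact (phi @` K).
  by apply: continuous_compact => //; exact: continuous_subspaceT.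
move=> /compact_bounded[B [_ BP]].
by exists B; split; rewrite ?num_real// => C BC x Kx; apply: BP => //; exists x.
Qed.

(** The closed boxes also lie in U, so that functions supported by them can
    serve as test functions, and locally integrable functions are integrable
    over them. The union is indexed by a set S, because in dimension 0 no box
    is empty, and the empty open set is only an empty union. *)
Lemma open_bigcup_obox U : open U ->
  exists (S : set nat) (p : nat -> 'rV[R]_n * 'rV[R]_n),
  (forall k, S k -> cbox (p k).1 (p k).2 `<=` U) /\
  U = \bigcup_(k in S) obox (p k).1 (p k).2.
Proof.
move=> oU; pose c (q : 'rV[rat]_n) : 'rV[R]_n := map_mx ratr q.
pose r (k m : nat) : R := k.+1%:R^-1 - m.+1%:R^-1.
(* inside the ball of center q and radius 1 / (k + 1), the boxes of center q and
   radius 1 / (k + 1) - 1 / (m + 1), so that their closures stay in the ball *)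
pose p (t : 'rV[rat]_n * nat * nat) : 'rV[R]_n * 'rV[R]_n :=
  (c t.1.1 - const_mx (r t.1.2 t.2), c t.1.1 + const_mx (r t.1.2 t.2)).
pose S := [set t : 'rV[rat]_n * nat * nat | ball (c t.1.1) t.1.2.+1%:R^-1 `<=` U].
have pU t : S t -> cbox (p t).1 (p t).2 `<=` U.
  move=> tU x xt; apply: tU; split; first by rewrite invr_gt0.
  move=> i j; rewrite (ord1 i) /ball/= distrC.
  have := xt j; rewrite in_itv/= !mxE -ler_distl => /le_lt_trans; apply.
  by rewrite ltrBlDr ltrDl invr_gt0.
have UE : U `<=` \bigcup_(t in S) obox (p t).1 (p t).2.
  move=> x; rewrite {1}(open_bigcup_ball_rat oU) => -[[q k] /= qkU [_ xq]].
  pose M := \big[Num.max/0]_i `|x ord0 i - ratr (q ord0 i)|.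
  have Mk : M < k.+1%:R^-1.
    apply: bigmax_lt; first by rewrite invr_gt0.
    by move=> i _; have := xq ord0 i; rewrite mxE /ball/= distrC.
  have [m mk] : exists m : nat, m.+1%:R^-1 < k.+1%:R^-1 - M.
    exists (Num.truncn (k.+1%:R^-1 - M)^-1).
    rewrite -ltf_pV2 ?posrE ?invr_gt0 ?subr_gt0// invrK.
    by rewrite truncnS_gt.
  exists (q, k, m) => // i; rewrite !mxE -ltr_distl.
  apply: (@le_lt_trans _ _ M); first
    exact: (le_bigmax _ (fun i => `|x ord0 i - ratr (q ord0 i)|)).
  by rewrite /r/= ltrBrDl -ltrBrDr.
exists [set k | exists2 t, unpickle k = Some t & S t].
exists (fun k => if unpickle k is Some t then p t else (0, 0)).
split=> [k [t -> tU]|]; first exact: pU.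
apply/seteqP; split=> [x /UE[t tU xt]|x [k [t /= -> tU] xt]].
  by exists (pickle t); [exists t; rewrite ?pickleK|rewrite pickleK].
exact/(pU _ tU)/obox_sub_cbox.
Qed.

Lemma measurable_sub_obox : @measurable _ 'rV[R]_n `<=`
  <<s [set B | exists a b, B = obox a b] >>.
Proof.
apply: smallest_sub; first exact: smallest_sigma_algebra.
move=> U oU; have [S [p [_ ->]]] := open_bigcup_obox oU.
rewrite bigcup_mkcond; apply: sigma_algebra_bigcup => k.
case: ifPn => _; last exact: sigma_algebra0.
by apply: sub_sigma_algebra; exists (p k).1, (p k).2.
Qed.

Lemma continuous_measurable_rV (g : 'rV[R]_n -> R) : continuous g ->
  measurable_fun setT g.
Proof.
move=> cg; apply: (measurability (@RGenOpens.G R) (RGenOpens.measurableE R)).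
move=> _ [_ [a [b ->]] <-]; rewrite setTI; apply: measurable_open_rV.
by apply: open_comp => [x _|]; [exact: cg|exact: interval_open].
Qed.

Lemma dot_delta_rV (x : 'rV[R]_n) i : dot_rV (delta_mx ord0 i) x = x ord0 i.
Proof. by rewrite dot_rVC dot_rV_delta. Qed.

(** The constant of expV tends to 0 as k tends to infinity, and so the bumps
    tend to the indicator function of the open box. *)
Definition smooth_bump (k : nat) a b x : R :=
  \prod_i (expV k.+1%:R^-1 1 (x ord0 i - a ord0 i) *
           expV k.+1%:R^-1 1 (b ord0 i - x ord0 i)).

Lemma expV1_itv (c t : R) : 0 < c -> 0 <= expV c 1 t <= 1.
Proof.
move=> c0; rewrite /expV; case: ifPn => [t0|_]; last by rewrite lexx ler01.
rewrite hornerC mul1r expR_ge0 expR_le1 oppr_le0.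
by rewrite divr_ge0// ltW.
Qed.

Lemma expV1_cvg (t : R) : 0 < t -> expV k.+1%:R^-1 1 t @[k --> \oo] --> (1 : R).
Proof.
move=> t0; rewrite (_ : (fun k : nat => _) =
    (fun k : nat => expR (- (t^-1 * (harmonic k : R))))); last first.
  by apply/funext => k; rewrite expV1_gt0// mulrC.
rewrite -expR0 -oppr0 -(mulr0 t^-1).
apply: continuous_cvg; first exact: continuous_expR.
apply: cvgN; apply: cvgM; first exact: cvg_cst.
exact: cvg_harmonic.
Qed.

Lemma Ck_smooth_bump k j a b : Ck k (smooth_bump j a b).
Proof.
apply: Ck_prod => i; apply: CkM.
  rewrite (_ : (fun x => _) = (fun x : 'rV[R]_n =>
    expV j.+1%:R^-1 1 (affine_rV (delta_mx ord0 i) (- a ord0 i) x))).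
    by apply: Ck_expV; rewrite invr_gt0.
  by apply/funext => x; rewrite /affine_rV dot_delta_rV.
rewrite (_ : (fun x => _) = (fun x : 'rV[R]_n =>
  expV j.+1%:R^-1 1 (affine_rV (- delta_mx ord0 i) (b ord0 i) x))).
  by apply: Ck_expV; rewrite invr_gt0.
apply/funext => x; rewrite /affine_rV -[- delta_mx _ _]scaleN1r dot_rVC dot_rVZr dot_rV_delta.
by rewrite mulN1r addrC.
Qed.

Lemma smooth_bump_itv k a b x : 0 <= smooth_bump k a b x <= 1.
Proof.
have h (t : R) : 0 <= expV k.+1%:R^-1 1 t <= 1.
  by apply: expV1_itv; rewrite invr_gt0.
apply/andP; split.
  apply: prodr_ge0 => i _.
  by apply: mulr_ge0; [case/andP: (h (x ord0 i - a ord0 i))|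
                       case/andP: (h (b ord0 i - x ord0 i))].
apply: prodr_ile1 => i _.
have /andP[h1 h2] := h (x ord0 i - a ord0 i).
have /andP[h3 h4] := h (b ord0 i - x ord0 i).
by rewrite mulr_ge0 ?mulr_ile1.
Qed.

Lemma smooth_bump_out k a b x : ~ obox a b x -> smooth_bump k a b x = 0.
Proof.
move=> /existsNP[i /negP]; rewrite negb_and -!leNgt => xab.
rewrite /smooth_bump (bigD1 i)//= [X in X * _](_ : _ = 0) ?mul0r//.
by case/orP: xab => h; rewrite /expV !subr_gt0 !ltNge h/= ?mul0r ?mulr0.
Qed.

Lemma smooth_bump_cvg a b x : smooth_bump k a b x @[k --> \oo] --> (\1_(obox a b) x : R).
Proof.
rewrite indicE; have [xab|xab] := boolP (x \in obox a b); last first.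
  under eq_fun do rewrite smooth_bump_out ?(negP _) -?notin_setE//.
  exact: cvg_cst.
have {}xab : obox a b x by rewrite inE in xab.
rewrite [X in _ --> X](_ : _ = \prod_(i < n) (1 * 1 : R)); last first.
  by rewrite big1// => i _; rewrite mulr1.
apply: cvg_big => [|i _]; first exact: mul_continuous.
by apply: cvgM; apply: expV1_cvg; have /andP[h1 h2] := xab i; rewrite subr_gt0.
Qed.

Lemma test_function_smooth_bump (Omega : set 'rV[R]_n) k a b :
  cbox a b `<=` Omega -> test_function Omega (smooth_bump k a b).
Proof.
move=> abO.
have sub : closure [set x | smooth_bump k a b x != 0] `<=` cbox a b.
  rewrite closureE; apply: smallest_sub; first exact: closed_cbox.
  move=> x /= bx; apply: obox_sub_cbox; apply: contrapT => /smooth_bump_out bx0.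
  by rewrite bx0 eqxx in bx.
split=> [j||]; first exact: Ck_smooth_bump.
- by apply: subclosed_compact sub; [exact: closed_closure|exact: compact_cbox].
- exact: subset_trans abO.
Qed.

End boxes.

(** * Integrals of partial derivatives *)

Section integral_partial.
Context {R : realType}.

Lemma continuous_into_rV (T : topologicalType) n (g : T -> 'rV[R]_n) :
  (forall i, continuous (fun t => g t ord0 i)) -> continuous g.
Proof.
move=> cg t; apply/cvg_ballP => e e0.
have H : \forall s \near t, forall i, ball (g t ord0 i) e (g s ord0 i).
  apply: filter_forall => i.
  by have /cvg_ballP := cg i t; apply.
by apply: filterS H => s h; split=> // i j; rewrite (ord1 i); exact: h.
Qed.

Definition supported_in_cube n (M : R) (F : 'rV[R]_n -> R) :=
  forall (x : 'rV[R]_n) i, M < `|x ord0 i| -> F x = 0.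

Lemma integrable_supported n (M : R) (F : 'rV[R]_n -> R) : 0 < M ->
  continuous F -> supported_in_cube M F ->
  (lebesgue_rV n).-integrable setT (EFin \o F).
Proof.
move=> M0 cF FM; set K := cbox (const_mx (- M)) (const_mx M : 'rV[R]_n).
have cK : compact K by exact: compact_cbox.
have mK : measurable K by exact: measurable_box_rV.
have -> : EFin \o F = (EFin \o F) \_ K.
  apply/funext => x; rewrite /patch; case: ifPn => // /negP xK /=.
  have [[i xi]|/forallNP xM] := pselect (exists i, M < `|x ord0 i|).
    by rewrite (FM _ _ xi).
  by case: xK; rewrite inE; exact: cubeP.
apply/(integrable_mkcond _ mK); apply: measurable_bounded_integrable => //.
- by apply: bounded_measure_lty => //; exact: compact_bounded.
- exact: measurable_funTS (continuous_measurable_rV cF).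
- exact: continuous_compact_bounded.
Qed.

Lemma integral_derive0 (M : R) (G dG : R -> R) : 0 < M ->
  continuous dG -> (forall t, is_derive t (1 : R) G (dG t)) ->
  (forall t, M < `|t| -> G t = 0) ->
  (\int[@lebesgue_measure R]_t (dG t)%:E = 0)%E.
Proof.
move=> M0 cdG dGE G0.
have dG0 t : M < `|t| -> dG t = 0.
  move=> Mt; have [_ <-] := dGE t.
  rewrite (@near_eq_derive _ _ _ _ (cst 0)) ?derive_cst//.
  near=> s; apply: G0; near: s.
  have cn : {for t, continuous (fun s : R => `|s|)} by exact: norm_continuous.
  exact: (cn _ (lt_nbhsr Mt)).
have cG : continuous G.
  by move=> t; apply/differentiable_continuous/derivable1_diffP; case: (dGE t).
rewrite (_ : (fun t => (dG t)%:E) =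
    (fun t => (dG t)%:E) \_ `[- (M + 1), M + 1]); last first.
  apply/funext => t; rewrite /patch; case: ifPn => // /negP.
  rewrite inE/= in_itv/= -ler_norml => /negP; rewrite -ltNge => h.
  by rewrite dG0// (lt_trans _ h)// ltrDl.
rewrite -integral_mkcond (@continuous_FTC2 _ dG G).
- rewrite !G0 ?sube0// ?normrN ger0_norm; lra.
- lra.
- exact: continuous_subspaceT.
- split=> [t _||]; first by case: (dGE t).
  + by apply: cvg_at_right_filter; exact: cG.
  + by apply: cvg_at_left_filter; exact: cG.
- by move=> t _; rewrite derive1E; case: (dGE t).
Unshelve. all: by end_near. Qed.

Lemma continuous_cons_rVl n (v : 'rV[R]_n) : continuous (fun t : R => cons_rV (t, v)).
Proof.
apply: continuous_into_rV => i; have [j ->|->] := unliftP ord0 i.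
  by under eq_fun do rewrite cons_rVS; exact: cst_continuous.
by under eq_fun do rewrite cons_rV0; move=> t; exact: cvg_id.
Qed.

Lemma continuous_cons_rVr n (t : R) : continuous (fun v : 'rV[R]_n => cons_rV (t, v)).
Proof.
apply: continuous_into_rV => i; have [j ->|->] := unliftP ord0 i.
  by under eq_fun do rewrite cons_rVS; exact: coord_continuous.
by under eq_fun do rewrite cons_rV0; exact: cst_continuous.
Qed.

(** Fubini's theorem along the decomposition of R^(n+1) as R * R^n: for the
    first coordinate the inner integral is one-dimensional and vanishes by the
    fundamental theorem of calculus; for the other coordinates it vanishes by
    induction. *)
Lemma integral_partial0 n (M : R) (F dF : 'rV[R]_n -> R) (i : 'I_n) : 0 < M ->
  continuous dF ->
  (forall x, is_derive x (delta_mx ord0 i) F (dF x)) ->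
  supported_in_cube M F -> supported_in_cube M dF ->
  (\int[lebesgue_rV n]_x (dF x)%:E = 0)%E.
Proof.
move=> M0; elim: n F dF i => [|n IH] F dF i cdF dFE FM dFM; first by have := ltn_ord i.
have mdF : measurable_fun setT (EFin \o dF).
  by apply/measurable_EFinP; exact: continuous_measurable_rV.
have mcons := @measurable_cons_rV R n.
have intdF := integrable_supported M0 cdF dFM.
have intcons : (@lebesgue_measure R \x lebesgue_rV n)%E.-integrable setT
    ((EFin \o dF) \o @cons_rV R n).
  apply/integrableP; split; first exact: measurableT_comp.
  have /integrableP[_] := intdF; rewrite [X in (X < _)%E -> _](_ : _ =
    (\int[pushforward (@lebesgue_measure R \x lebesgue_rV n)%E (@cons_rV R n)]_x
       `|(EFin \o dF) x|)%E)//.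
  by rewrite ge0_integral_pushforward//; exact: measurableT_comp.
transitivity (\int[pushforward (@lebesgue_measure R \x lebesgue_rV n)%E
    (@cons_rV R n)]_x (EFin \o dF) x)%E => //.
rewrite integral_pushforward// preimage_setT.
have [j ij|i0] := unliftP ord0 i.
- rewrite -integral12_prod_meas1//; apply: integral0_eq => t _.
  apply: (IH (fun v => F (cons_rV (t, v))) _ j).
  + by move=> v; apply: continuous_comp; [exact: continuous_cons_rVr|exact: cdF].
  + move=> v; apply: is_derive_path (dFE (cons_rV (t, v))) => h.
    rewrite (_ : delta_mx ord0 i = cons_rV (0, delta_mx ord0 j)).
      by rewrite cons_rVZ cons_rVD mulr0 add0r.
    apply/rowP => k; rewrite ij; have [l ->|->] := unliftP ord0 k.
      by rewrite cons_rVS !mxE (inj_eq lift_inj).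
    by rewrite cons_rV0 mxE.
  + by move=> v k Mv; apply: (FM _ (lift ord0 k)); rewrite cons_rVS.
  + by move=> v k Mv; apply: (dFM _ (lift ord0 k)); rewrite cons_rVS.
- rewrite -integral21_prod_meas1//; apply: integral0_eq => v _.
  apply: (@integral_derive0 M (fun t => F (cons_rV (t, v)))) => //.
  + by move=> t; apply: continuous_comp; [exact: continuous_cons_rVl|exact: cdF].
  + move=> t; apply: is_derive_path (dFE (cons_rV (t, v))) => h.
    rewrite (_ : delta_mx ord0 i = cons_rV (1, 0)).
      by rewrite cons_rVZ cons_rVD scaler0 add0r.
    apply/rowP => k; rewrite i0; have [l ->|->] := unliftP ord0 k.
      by rewrite cons_rVS !mxE.
    by rewrite cons_rV0 mxE.
  + by move=> t Mt; apply: (FM _ ord0); rewrite cons_rV0.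
Qed.

End integral_partial.

(** * Test functions and the du Bois-Reymond lemma *)

Section test_functions.
Context {R : realType} {n : nat} (Omega : set 'rV[R]_n).
Implicit Types (phi psi u v : 'rV[R]_n -> R).
Local Notation mu := (@lebesgue_rV R n).
Local Notation supp phi := (closure [set x | phi x != 0]).

Lemma supp_out phi x : ~ supp phi x -> phi x = 0.
Proof.
move=> xphi; apply/eqP; apply/negP => /negP phix; apply: xphi.
exact: (@subset_closure _ [set x | phi x != 0]).
Qed.

Lemma continuous_loc_integrable phi : continuous phi -> loc_integrable Omega phi.
Proof.
move=> cphi K cK _.
have mK : measurable K.
  by apply: measurable_closed_rV; apply: compact_closed => //; exact: norm_hausdorff.
apply: measurable_bounded_integrable => //.
- by apply: bounded_measure_lty => //; exact: compact_bounded.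
- exact: measurable_funTS (continuous_measurable_rV cphi).
- exact: continuous_compact_bounded.
Qed.

Lemma test_function_sub phi psi : test_function Omega phi ->
  (forall k, Ck k psi) -> (forall x, ~ supp phi x -> psi x = 0) ->
  test_function Omega psi.
Proof.
move=> [Cphi Kphi phiO] Cpsi psi0.
have sub : supp psi `<=` supp phi.
  rewrite [X in X `<=` _]closureE; apply: smallest_sub; first exact: closed_closure.
  by move=> x /= px; apply: contrapT => /psi0 px0; rewrite px0 eqxx in px.
split=> //; last exact: subset_trans phiO.
by apply: subclosed_compact sub => //; exact: closed_closure.
Qed.

Lemma test_functionM phi psi : test_function Omega phi -> (forall k, Ck k psi) ->
  test_function Omega (fun x => psi x * phi x).
Proof.
move=> tphi Cpsi; apply: (test_function_sub tphi) => [k|x /supp_out ->].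
  by apply: CkM => //; case: tphi.
by rewrite mulr0.
Qed.

Lemma partial_supp_out phi i x : ~ supp phi x -> partial i phi x = 0.
Proof.
move=> xphi; rewrite /partial (@near_eq_derive _ _ _ _ (cst 0)) ?derive_cst//.
have : open (~` supp phi) by apply: closed_openC; exact: closed_closure.
rewrite openE => /(_ _ xphi); apply: filterS => y.
exact: supp_out.
Qed.

Lemma test_function_partial phi i : test_function Omega phi ->
  test_function Omega (partial i phi).
Proof.
move=> tphi; apply: (test_function_sub tphi) => [k|x]; last exact: partial_supp_out.
by apply: Ck_partial; case: tphi.
Qed.

Lemma test_function0 : test_function Omega (fun=> 0).
Proof.
have S0 : [set x : 'rV[R]_n | (0 : R) != 0] = set0.
  by apply/seteqP; split=> // x /=; rewrite eqxx.
split; first (by move=> k; exact: Ck_cst); rewrite S0 closure0.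
  exact: compact0.
exact: sub0set.
Qed.

Hypothesis Omega_open : open Omega.
Let mOmega : measurable Omega := measurable_open_rV Omega_open.

Lemma integrable_supp (K : set 'rV[R]_n) (g : 'rV[R]_n -> R) : measurable K ->
  K `<=` Omega -> (forall x, ~ K x -> g x = 0) ->
  mu.-integrable K (EFin \o g) -> mu.-integrable Omega (EFin \o g).
Proof.
move=> mK KO g0 /(integrable_mkcond _ mK) intg; apply/(integrable_mkcond _ mOmega).
apply: eq_integrable intg => // x _; rewrite /patch.
case: ifPn => [/set_mem/KO/mem_set -> //|]; rewrite notin_setE => /g0 gx0.
by rewrite /= gx0 if_same.
Qed.

Lemma loc_integrableM_test v phi : loc_integrable Omega v ->
  test_function Omega phi -> mu.-integrable Omega (EFin \o (fun x => v x * phi x)).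
Proof.
move=> lv [Cphi Kphi phiO].
have cphi : continuous phi := Ck_continuous (Cphi 0%N).
have mK : measurable (supp phi) by apply: measurable_closed_rV; exact: closed_closure.
apply: (integrable_supp mK) => // [x /supp_out ->|]; first by rewrite mulr0.
apply: (integrableMl mK (lv _ Kphi phiO)).
  exact: measurable_funTS (continuous_measurable_rV cphi).
exact: continuous_compact_bounded.
Qed.

Lemma integrable_test phi : test_function Omega phi ->
  mu.-integrable Omega (EFin \o phi).
Proof.
move=> tphi; have -> : phi = (fun x => 1 * phi x) by apply/funext => x; rewrite mul1r.
apply: loc_integrableM_test => //.
by apply: continuous_loc_integrable; exact: cst_continuous.
Qed.

Lemma Rintegral_partial_test phi i : test_function Omega phi ->
  \int[mu]_(x in Omega) partial i phi x = 0.
Proof.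
move=> [Cphi Kphi phiO].
have [M M0 KM] := bounded_in_cube (compact_bounded Kphi).
have cube0 (x : 'rV[R]_n) j : M < `|x ord0 j| -> ~ supp phi x.
  move=> Mx /KM /(_ j); rewrite in_itv/= !mxE -ler_norml => /le_lt_trans/(_ Mx).
  by rewrite ltxx.
rewrite /Rintegral integral_mkcond.
rewrite (_ : _ \_ Omega = (fun x => (partial i phi x)%:E)).
  have cd : continuous (partial i phi).
    by apply: (@Ck_continuous _ _ 0); exact: (Ck_partial i (Cphi 1%N)).
  have dphi x := Ck_derive i x (Cphi 1%N).
  by rewrite (integral_partial0 M0 cd dphi) => [|x j /cube0/supp_out|x j /cube0/partial_supp_out].
apply/funext => x; rewrite /patch; case: ifPn => //; rewrite notin_setE => xO.
by rewrite partial_supp_out// => /phiO.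
Qed.

(** The du Bois-Reymond lemma. By dominated convergence along the bumps, v has
    integral zero over every open box with closure in Omega. Within one such
    box Q, the intersections with open boxes form a pi-system that generates
    the Borel sets, so v = 0 almost everywhere on Q; countably many Q cover
    Omega. *)
Lemma loc_integrable_test_ae0 v : loc_integrable Omega v ->
  (forall phi, test_function Omega phi -> \int[mu]_(x in Omega) (v x * phi x) = 0) ->
  {ae mu, forall x, Omega x -> v x = 0}.
Proof.
move=> lv v0.
have box0 a b : cbox a b `<=` Omega ->
    (\int[mu]_(x in obox a b) (v x)%:E = 0)%E.
  move=> abO; have mc : measurable (cbox a b) by exact: measurable_box_rV.
  have intv := lv _ (@compact_cbox R n a b) abO.
  have mv : measurable_fun (cbox a b) v by apply/measurable_EFinP; exact: measurable_int intv.
  pose f_ k x := (v x * smooth_bump k a b x)%:E.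
  have If_ k : (\int[mu]_(x in cbox a b) f_ k x = 0)%E.
    have tb := test_function_smooth_bump k abO.
    have := integral_EFin mOmega (loc_integrableM_test lv tb).
    rewrite v0// => I0; transitivity (0%R%:E : \bar R) => //; rewrite -I0.
    rewrite [LHS]integral_mkcond [RHS]integral_mkcond; apply: eq_integral => x _.
    rewrite /patch; case: ifPn => [/set_mem/abO/mem_set -> //|].
    rewrite notin_setE => xab; rewrite /= smooth_bump_out ?mulr0 ?if_same//.
    by move/obox_sub_cbox.
  have mbump k : measurable_fun (cbox a b) (smooth_bump k a b).
    apply: measurable_funTS; apply: continuous_measurable_rV.
    exact: (Ck_continuous (Ck_smooth_bump 0 k a b)).
  pose f x := (v x * \1_(obox a b) x)%:E.
  have mf_ k : measurable_fun (cbox a b) (f_ k).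
    by apply/measurable_EFinP; exact: measurable_funM.
  have mf : measurable_fun (cbox a b) f.
    apply/measurable_EFinP; apply: measurable_funM => //.
    by apply: measurable_indic; exact: measurable_obox.
  have f_f : {ae mu, forall x, cbox a b x -> f_ ^~ x @ \oo --> f x}.
    apply/aeW => x _; apply: cvg_EFin; first by near=> k.
    by apply: cvgM; [exact: cvg_cst|exact: smooth_bump_cvg].
  have f_g : {ae mu, forall x k, cbox a b x -> (`|f_ k x| <= `|(v x)%:E|)%E}.
    apply/aeW => x k _; rewrite /f_ !abse_EFin lee_fin normrM ler_piMr//.
    by have /andP[b0 b1] := smooth_bump_itv k a b x; rewrite ger0_norm.
  have [_ _] := dominated_convergence mc mf_ mf f_f (integrable_abse intv) f_g.
  rewrite (_ : [sequence _]_k = cst 0%E); last by apply/funext => k; exact: If_.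
  move=> /(cvg_unique (@ereal_hausdorff R) (cvg_cst 0%E)) => I0.
  rewrite [RHS]I0 [LHS]integral_mkcond [RHS]integral_mkcond; apply: eq_integral => x _.
  rewrite /patch /f indicE; case: ifPn => [xo|_]; last by rewrite mulr0 if_same.
  by rewrite mulr1 mem_set//; apply: obox_sub_cbox; rewrite inE in xo.
have [S [p [pO OE]]] := open_bigcup_obox Omega_open.
suff : {ae mu, forall x k, S k -> obox (p k).1 (p k).2 x -> v x = 0}.
  apply: filterS => x h Ox; have := Ox; rewrite {1}OE => -[k Sk xk].
  exact: h Sk xk.
apply: ae_foralln => k; have [Sk|nSk] := pselect (S k); last first.
  by apply/aeW => x /nSk.
suff H : {ae mu, forall x, obox (p k).1 (p k).2 x -> v x = 0}.
  by apply: filterS H => x h _.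
apply: (@integral_pi_system_ae0 _ _ _ _ [set B | exists a b, B = obox a b]).
- exact: measurable_sub_obox.
- by move=> _ [a [b ->]]; exact: measurable_obox.
- by move=> _ _ [a [b ->]] [a' [b' ->]]; rewrite oboxI; do 2 eexists.
- exact: measurable_obox.
- have := lv _ (@compact_cbox R n (p k).1 (p k).2) (pO _ Sk).
  by apply: integrableS; [exact: measurable_box_rV|exact: measurable_obox|exact: obox_sub_cbox].
- exact: box0 (pO _ Sk).
- move=> _ [a [b ->]]; rewrite oboxI; apply: box0; apply: subset_trans (pO _ Sk).
  move=> x xab i; have := xab i.
  by rewrite !in_itv/= !mxE ge_max le_min => /andP[/andP[-> _] /andP[-> _]].
Unshelve. all: by end_near. Qed.

End test_functions.

(** * Weak partial derivatives *)

Section ae_bounds.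
Context d (T : measurableType d) {R : realType} (mu : {measure set T -> \bar R}).
Variables (D : set T) (mD : measurable D).

Lemma ae_le_integrable (h g : T -> R) : measurable_fun D h ->
  mu.-integrable D (EFin \o g) -> {ae mu, forall x, D x -> `|h x| <= g x} ->
  mu.-integrable D (EFin \o h).
Proof.
move=> mh intg hg; apply/integrableP; split; first exact/measurable_EFinP.
have /integrableP[mg] := intg; apply: le_lt_trans.
apply: ae_ge0_le_integral => //.
- by apply: measurableT_comp => //; exact/measurable_EFinP.
- exact: measurableT_comp.
- apply: filterS hg => x h0 Dx; rewrite /= lee_fin.
  by rewrite (le_trans (h0 Dx))// ler_norm.
Qed.

Lemma ae_le_Rintegral (h g : T -> R) :
  mu.-integrable D (EFin \o h) -> mu.-integrable D (EFin \o g) ->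
  {ae mu, forall x, D x -> h x <= g x} ->
  \int[mu]_(x in D) h x <= \int[mu]_(x in D) g x.
Proof.
move=> inth intg hg; rewrite -subr_ge0 -RintegralB//.
have intgh : mu.-integrable D (EFin \o (fun x => g x - h x)).
  exact: (integrableB mD intg inth).
rewrite -lee_fin -integral_EFin//.
rewrite (_ : (\int[mu]_(x in D) (g x - h x)%:E =
    \int[mu]_(x in D) `|(g x - h x)%:E|)%E); first exact: integral_ge0.
have mgh := measurable_int mu intgh.
apply: ae_eq_integral => //; first exact: measurableT_comp.
by apply: filterS hg => x hx Dx; rewrite /= ger0_norm// subr_ge0 hx.
Qed.

End ae_bounds.

Section weak_partial.
Context {R : realType} {n : nat} (Omega : set 'rV[R]_n).
Implicit Types (phi psi u v w : 'rV[R]_n -> R).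
Local Notation mu := (@lebesgue_rV R n).
Hypothesis Omega_open : open Omega.
Let mOmega : measurable Omega := measurable_open_rV Omega_open.

Lemma loc_integrableD u v : loc_integrable Omega u -> loc_integrable Omega v ->
  loc_integrable Omega (fun x => u x + v x).
Proof.
move=> lu lv K cK KO.
have mK : measurable K.
  by apply: measurable_closed_rV; apply: compact_closed => //; exact: norm_hausdorff.
exact: (integrableD mK (lu K cK KO) (lv K cK KO)).
Qed.

Lemma loc_integrableB u v : loc_integrable Omega u -> loc_integrable Omega v ->
  loc_integrable Omega (fun x => u x - v x).
Proof.
move=> lu lv K cK KO.
have mK : measurable K.
  by apply: measurable_closed_rV; apply: compact_closed => //; exact: norm_hausdorff.
exact: (integrableB mK (lu K cK KO) (lv K cK KO)).
Qed.

Lemma loc_integrable_measurable v : loc_integrable Omega v -> measurable_fun Omega v.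
Proof.
move=> lv; have [S [p [pO OE]]] := open_bigcup_obox Omega_open.
rewrite OE bigcup_mkcond; apply/measurable_fun_bigcup => k.
  by case: ifPn => _; [exact: measurable_obox|exact: measurable0].
case: ifPn => [Sk|_]; last exact: measurable_fun_set0.
apply/measurable_EFinP; apply: (@measurable_int _ _ _ mu).
have := lv _ (@compact_cbox R n (p k).1 (p k).2) (pO _ (set_mem Sk)).
by apply: integrableS; [exact: measurable_box_rV|exact: measurable_obox|exact: obox_sub_cbox].
Qed.

Lemma is_weak_partialD i u1 u2 v1 v2 : is_weak_partial Omega i u1 v1 ->
  is_weak_partial Omega i u2 v2 ->
  is_weak_partial Omega i (fun x => u1 x + u2 x) (fun x => v1 x + v2 x).
Proof.
move=> [lu1 lv1 uv1] [lu2 lv2 uv2]; split; [exact: loc_integrableD..|].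
move=> phi tphi.
under eq_Rintegral do rewrite mulrDl.
under [in RHS]eq_Rintegral do rewrite mulrDl.
rewrite !RintegralD//; [|exact: loc_integrableM_test|exact: loc_integrableM_test
  |by apply: loc_integrableM_test => //; exact: test_function_partial..].
by rewrite uv1// uv2// opprD.
Qed.

Lemma is_weak_partialB i u1 u2 v1 v2 : is_weak_partial Omega i u1 v1 ->
  is_weak_partial Omega i u2 v2 ->
  is_weak_partial Omega i (fun x => u1 x - u2 x) (fun x => v1 x - v2 x).
Proof.
move=> [lu1 lv1 uv1] [lu2 lv2 uv2]; split; [exact: loc_integrableB..|].
move=> phi tphi.
under eq_Rintegral do rewrite mulrBl.
under [in RHS]eq_Rintegral do rewrite mulrBl.
rewrite !RintegralB//; [|exact: loc_integrableM_test|exact: loc_integrableM_test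
  |by apply: loc_integrableM_test => //; exact: test_function_partial..].
by rewrite uv1// uv2// opprB opprK addrC.
Qed.

(** Integration by parts: u phi is again a test function, and the integral of
    its partial derivative is zero. *)
Lemma is_weak_partial_Ck i u : (forall k, Ck k u) ->
  is_weak_partial Omega i u (partial i u).
Proof.
move=> Cu.
have lu : loc_integrable Omega u.
  exact: continuous_loc_integrable (Ck_continuous (Cu 0%N)).
have ldu : loc_integrable Omega (partial i u).
  by apply: continuous_loc_integrable; exact: (Ck_continuous (Ck_partial i (Cu 1%N))).
split=> // phi tphi; apply/eqP; rewrite -addr_eq0 -RintegralD//.
- rewrite -[eqbRHS](Rintegral_partial_test i (test_functionM tphi Cu)).
  apply/eqP; apply: eq_Rintegral => x _.
  by rewrite partialM//; [rewrite [X in _ + X]mulrC|case: tphi].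
- by apply: loc_integrableM_test => //; exact: test_function_partial.
- exact: loc_integrableM_test.
Qed.

Lemma weak_partial_unique i u v1 v2 : is_weak_partial Omega i u v1 ->
  is_weak_partial Omega i u v2 -> {ae mu, forall x, Omega x -> v1 x = v2 x}.
Proof.
move=> [_ lv1 uv1] [_ lv2 uv2].
have := @loc_integrable_test_ae0 _ _ _ Omega_open _ (loc_integrableB lv1 lv2).
move=> H; have {}H : {ae mu, forall x, Omega x -> v1 x - v2 x = 0}.
  apply: H => phi tphi; under eq_Rintegral do rewrite mulrBl.
  rewrite RintegralB//; [|exact: loc_integrableM_test..].
  by apply/eqP; rewrite subr_eq0 -eqr_opp -uv1// -uv2.
by apply: filterS H => x h Ox; apply/eqP; rewrite -subr_eq0 h.
Qed.

Lemma weak_partialP i u v : is_weak_partial Omega i u v ->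
  is_weak_partial Omega i u (weak_partial Omega i u).
Proof. exact: xgetI. Qed.

Lemma weak_partial_ae i u v : is_weak_partial Omega i u v ->
  {ae mu, forall x, Omega x -> weak_partial Omega i u x = v x}.
Proof. by move=> uv; apply: weak_partial_unique (weak_partialP uv) uv. Qed.

Lemma Lp1_integrable u : Lp_on Omega 1%E u <-> mu.-integrable Omega (EFin \o u).
Proof.
rewrite /Lp_on; split => [/Lfun1_integrable|].
  by rewrite -restrict_EFin => /(integrable_mkcond _ mOmega).
by move=> /(integrable_mkcond _ mOmega); rewrite restrict_EFin => /Lfun1_integrable.
Qed.

Lemma Lnorm1_on u : ('N[mu]_1 [EFin \o (u \_ Omega)] =
  \int[mu]_(x in Omega) `|u x|%:E)%E.
Proof.
rewrite Lnorm1 [RHS]integral_mkcond; apply: eq_integral => x _.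
by rewrite /= !patchE; case: ifPn => //; rewrite normr0.
Qed.

(** The W^(1,1) norm of w - phi involves chosen weak derivatives; by uniqueness
    they agree almost everywhere with the differences v i - partial i phi, which
    are the quantities that the estimates use. *)
Lemma W1oo_0_approx w (v : 'I_n -> 'rV[R]_n -> R) (e : R) : W1oo_0 Omega w ->
  mu.-integrable Omega (EFin \o w) ->
  (forall i, is_weak_partial Omega i w (v i)) ->
  (forall i, mu.-integrable Omega (EFin \o v i)) -> 0 < e ->
  exists phi, [/\ test_function Omega phi,
    \int[mu]_(x in Omega) `|w x - phi x| < e &
    forall i, \int[mu]_(x in Omega) `|v i x - partial i phi x| < e].
Proof.
move=> [_ _ approx] intw wv intv e0; have [phi tphi] := approx _ e0.
have ge0 (g : 'rV[R]_n -> R) : (0 <= 'N[mu]_1 [EFin \o (g \_ Omega)])%E.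
  exact: Lnorm_ge0.
rewrite /W11_norm => We.
have [Cphi _ _] := tphi.
have dphi i := is_weak_partialB (wv i) (is_weak_partial_Ck i Cphi).
have nw := ge0 (fun x => w x - phi x).
have nd i := ge0 (weak_partial Omega i (fun x => w x - phi x)).
have intwphi := integrableB mOmega intw (integrable_test Omega_open tphi).
have intdphi i := integrableB mOmega (intv i)
  (integrable_test Omega_open (test_function_partial i tphi)).
exists phi; split=> // [|i].
  rewrite -lte_fin -integral_EFin//; last exact: (integrable_abse intwphi).
  apply: le_lt_trans We; rewrite -Lnorm1_on; apply: leeDl.
  by apply: sume_ge0 => i _; exact: nd.
rewrite -lte_fin -integral_EFin//; last exact: (integrable_abse (intdphi i)).
apply: le_lt_trans We.
apply: (@le_trans _ _ ('N[mu]_1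
    [EFin \o (weak_partial Omega i (fun x => w x - phi x)%R \_ Omega)])%E); last first.
  apply: (@le_trans _ _ (\sum_(i < n) 'N[mu]_1
      [EFin \o (weak_partial Omega i (fun x => w x - phi x)%R \_ Omega)])%E).
    by rewrite (bigD1 i)//= leeDl// sume_ge0// => j _; exact: nd.
  exact: leeDr.
rewrite Lnorm1_on le_eqVlt; apply/orP; left; apply/eqP.
have [_ lz _] := weak_partialP (dphi i).
apply: ge0_ae_eq_integral => //.
- exact: (measurable_int mu (integrable_abse (intdphi i))).
- apply: measurableT_comp => //; apply: measurableT_comp => //.
  exact: loc_integrable_measurable.
- by apply: filterS (weak_partial_ae (dphi i)) => x h Ox; rewrite /= h.
Qed.

End weak_partial.

(** * Functions of W^{1,oo}_0 and extremal directions *)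

Section W1oo_0_facts.
Context {R : realType} {n : nat} (Omega : set 'rV[R]_n).
Local Notation mu := (@lebesgue_rV R n).
Hypotheses (Omega_open : open Omega) (Omega_bounded : bounded_set Omega).
Let mOmega : measurable Omega := measurable_open_rV Omega_open.

Lemma Lpoo_bounded (w : 'rV[R]_n -> R) : Lp_on Omega +oo%E w ->
  exists2 M, 0 <= M & {ae mu, forall x, Omega x -> `|w x| <= M}.
Proof.
move=> /sub_Lfun_finLfun; rewrite inE /= /finite_norm unlock.
case: ifPn => [mu0|]; last first.
  rewrite -leNgt measure_le0 => /eqP mu0 _; exists 0 => //.
  by exists setT; split.
move=> Mlt; set N := ess_sup _ _ in Mlt.
have Nge : {ae mu, forall x, (`|(w \_ Omega) x|%:E <= N)%E} by exact: ess_sup_ge.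
exists `|fine N| => //; apply: filterS Nge => x + Ox.
rewrite patchE mem_set//; case: N Mlt => [r _| |]//=.
by rewrite lee_fin => /le_trans; apply; exact: ler_norm.
Qed.

(** The partial derivatives of test functions have integral zero, and this
    passes to the limit. *)
Lemma W1oo_0_mean_grad (w : 'rV[R]_n -> R) (v : 'I_n -> 'rV[R]_n -> R) i :
  W1oo_0 Omega w -> mu.-integrable Omega (EFin \o w) ->
  (forall i, is_weak_partial Omega i w (v i)) ->
  (forall i, mu.-integrable Omega (EFin \o v i)) ->
  \int[mu]_(x in Omega) v i x = 0.
Proof.
move=> Ww intw wv intv; apply/eqP; rewrite -normr_le0; apply/ler_addgt0Pl => e e0.
rewrite addr0; have [phi [tphi _ vphi]] := W1oo_0_approx Omega_open Ww intw wv intv e0.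
have intdphi := integrable_test Omega_open (test_function_partial i tphi).
rewrite -[\int[mu]_(x in Omega) v i x]subr0 -[X in _ - X](Rintegral_partial_test i tphi).
rewrite -RintegralB//; apply: le_trans (ltW (vphi i)).
by apply: le_normr_Rintegral => //; exact: (integrableB mOmega (intv i) intdphi).
Qed.

(** Let l x = <alpha, x>, and let D denote the derivative in the direction
    alpha. Since D w = 0, testing w against z = l phi gives that w D z has
    integral zero, where D z = |alpha|^2 phi + l D phi. As phi tends to w, the
    first term yields |alpha|^2 times the integral of w^2. The second tends to
    0, because D phi tends to D w = 0 in L^1 while w and l are bounded. *)
Lemma W1oo_0_directional_eq0 (w : 'rV[R]_n -> R) (v : 'I_n -> 'rV[R]_n -> R)
    (alpha : 'rV[R]_n) : alpha != 0 ->
  W1oo_0 Omega w -> mu.-integrable Omega (EFin \o w) ->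
  (forall i, is_weak_partial Omega i w (v i)) ->
  (forall i, mu.-integrable Omega (EFin \o v i)) ->
  {ae mu, forall x, Omega x -> \sum_i alpha ord0 i * v i x = 0} ->
  {ae mu, forall x, Omega x -> w x = 0}.
Proof.
move=> alpha0 Ww intw wv intv av0.
have [[+ _] _ _] := Ww; move=> /Lpoo_bounded[M M0 wM].
pose A := dot_rV alpha alpha.
have A0 : 0 < A.
  have sq0 i : 0 <= alpha ord0 i * alpha ord0 i by rewrite -expr2 sqr_ge0.
  rewrite lt_def sumr_ge0// andbT; apply: contra alpha0 => /eqP A0.
  apply/eqP/rowP => i; rewrite mxE; apply/eqP.
  by rewrite -[_ == 0]orbb -mulf_eq0; apply/eqP; exact: (psumr_eq0P _ A0).
pose l := affine_rV alpha 0.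
have Cl k : Ck k l by exact: Ck_affine.
have [L L0 lL] : exists2 L, 0 <= L & forall x, Omega x -> `|l x| <= L.
  have [B _ OB] := bounded_in_cube Omega_bounded.
  have [C [_ CP]] := continuous_compact_bounded
    (@compact_cbox R n (const_mx (- B)) (const_mx B)) (Ck_continuous (Cl 0%N)).
  exists (`|C| + 1) => [|x Ox]; first by rewrite addr_ge0.
  by apply: CP (OB _ Ox); rewrite (le_lt_trans (ler_norm C))// ltrDl.
have mw : measurable_fun Omega w by apply/measurable_EFinP; exact: measurable_int intw.
pose S := \sum_i `|alpha ord0 i|.
pose C := A * M + M * L * S.
have C0 : 0 <= C.
  by rewrite addr_ge0// !mulr_ge0 ?(ltW A0)// sumr_ge0.
have intww : mu.-integrable Omega (EFin \o (fun x => w x * w x)).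
  apply: (ae_le_integrable mOmega (g := fun x => M * `|w x|)).
  - exact: measurable_funM.
  - exact: (integrableZl mOmega M (integrable_abse intw)).
  - by apply: filterS wM => x h Ox; rewrite normrM ler_wpM2r// h.
(* SF has integral zero by testing, and A w^2 - SF is controlled by the distances
   E0 and E of the approximation *)
have key e : 0 < e -> A * \int[mu]_(x in Omega) (w x * w x) <= C * e.
  move=> e0; have [phi [tphi wphi vphi]] := W1oo_0_approx Omega_open Ww intw wv intv e0.
  have [Cphi _ _] := tphi.
  have lw : loc_integrable Omega w.
    move=> K cK KO; apply: integrableS intw => //; apply: measurable_closed_rV.
    by apply: compact_closed => //; exact: norm_hausdorff.
  have tz := test_functionM tphi Cl; set z := fun x => _ in tz.
  pose F i x := w x * partial i z x.
  pose G i x := v i x * z x.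
  have intF i : mu.-integrable Omega (EFin \o F i).
    by apply: loc_integrableM_test => //; exact: test_function_partial.
  have intG i : mu.-integrable Omega (EFin \o G i).
    by apply: loc_integrableM_test => //; case: (wv i).
  pose SF x := \sum_i alpha ord0 i * F i x.
  have intSF : mu.-integrable Omega (EFin \o SF) by exact: integrable_lin.
  have SF0 : \int[mu]_(x in Omega) SF x = 0.
    rewrite /SF Rintegral_lin//.
    transitivity (- \int[mu]_(x in Omega) \sum_i alpha ord0 i * G i x).
      rewrite Rintegral_lin// -sumrN; apply: eq_bigr => i _.
      by have [_ _ ->] := wv i => //; rewrite mulrN.
    apply/eqP; rewrite oppr_eq0; apply/eqP.
    rewrite /Rintegral (_ : integral _ _ _ = 0%E)//.
    transitivity (\int[mu]_(x in Omega) (cst 0 x : \bar R))%E; last exact: integral0.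
    apply: ae_eq_integral => //.
      exact: (measurable_int mu (integrable_lin mOmega (fun i => alpha ord0 i) intG)).
    apply: filterS av0 => x h Ox /=; congr EFin.
    transitivity ((\sum_i alpha ord0 i * v i x) * z x); last by rewrite h// mul0r.
    rewrite mulr_suml; by apply: eq_bigr => i _; rewrite mulrA.
  have SFE x : SF x = A * (w x * phi x) +
      w x * l x * \sum_i alpha ord0 i * partial i phi x.
    rewrite /A /dot_rV mulr_suml mulr_sumr -big_split; apply: eq_bigr => i _.
    rewrite /F /z partialM// partial_affine /=; ring.
  pose E0 x := `|w x - phi x|; pose E i x := `|v i x - partial i phi x|.
  have intE0 : mu.-integrable Omega (EFin \o E0).
    exact: (integrable_abse (integrableB mOmega intw (integrable_test Omega_open tphi))).
  have intE i : mu.-integrable Omega (EFin \o E i).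
    exact: (integrable_abse (integrableB mOmega (intv i)
      (integrable_test Omega_open (test_function_partial i tphi)))).
  pose SE x := \sum_i `|alpha ord0 i| * E i x.
  have intSE : mu.-integrable Omega (EFin \o SE) by exact: integrable_lin.
  have intAww : mu.-integrable Omega (EFin \o (fun x => A * (w x * w x))).
    exact: (integrableZl mOmega A intww).
  have intAE : mu.-integrable Omega (EFin \o (fun x => A * M * E0 x)).
    exact: (integrableZl mOmega (A * M) intE0).
  have intLE : mu.-integrable Omega (EFin \o (fun x => M * L * SE x)).
    exact: (integrableZl mOmega (M * L) intSE).
  rewrite -RintegralZl// -[leLHS]subr0 -[X in _ - X]SF0 -RintegralB//.
  apply: (@le_trans _ _ (\int[mu]_(x in Omega) (A * M * E0 x + M * L * SE x))).
    apply: (ae_le_Rintegral mOmega).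
    - exact: (integrableB mOmega intAww intSF).
    - exact: (integrableD mOmega intAE intLE).
    apply: filterS2 wM av0 => x wMx avx Ox.
    have -> : A * (w x * w x) - SF x = A * (w x * (w x - phi x)) +
        w x * l x * \sum_i alpha ord0 i * (v i x - partial i phi x).
      rewrite SFE; under [in RHS]eq_bigr do rewrite mulrBr.
      by rewrite sumrB avx//; ring.
    rewrite (le_trans (ler_norm _))// (le_trans (ler_normD _ _))// lerD//.
      rewrite !normrM (gtr0_norm A0) -mulrA ler_wpM2l ?(ltW A0)//.
      by rewrite ler_wpM2r// wMx.
    rewrite !normrM ler_pM ?mulr_ge0// ?ler_pM ?wMx ?lL//.
    rewrite (le_trans (ler_norm_sum _ _ _))// ler_sum// => i _.
    by rewrite normrM.
  rewrite RintegralD// RintegralZl// RintegralZl// mulrDl lerD//.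
    by rewrite ler_wpM2l ?(ltW wphi)// mulr_ge0// ltW.
  rewrite -[leRHS]mulrA ler_wpM2l ?mulr_ge0// /SE Rintegral_lin// mulr_suml.
  apply: ler_sum => i _; rewrite ler_wpM2l//; exact: ltW (vphi i).
have ww0 : \int[mu]_(x in Omega) (w x * w x) = 0.
  apply/eqP; rewrite eq_le Rintegral_ge0 ?andbT; last first.
    by move=> x _; rewrite -expr2 sqr_ge0.
  rewrite -(pmulr_rle0 _ A0); apply/ler_addgt0Pl => e e0; rewrite addr0.
  have C1 : 0 < C + 1 by rewrite ltr_pwDr.
  apply: le_trans (key _ (divr_gt0 e0 C1)) _.
  by rewrite mulrCA ger_pMr// ler_pdivrMr// mul1r lerDl.
have : {ae mu, forall x, Omega x -> w x * w x = 0}.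
  by apply: Rintegral_eq0_ae => //; apply/aeW => x _; rewrite -expr2 sqr_ge0.
by apply: filterS => x h /h /eqP; rewrite mulf_eq0 orbb => /eqP.
Qed.

End W1oo_0_facts.

Section face.
Context d (T : measurableType d) {R : realType} (mu : {measure set T -> \bar R}).

Lemma mean_in_convex (D : set T) n (h : T -> 'rV[R]_n) (L : set 'rV[R]_n) :
  measurable D -> (0 < mu D)%E -> (mu D < +oo)%E ->
  (forall i, mu.-integrable D (EFin \o (fun x => h x ord0 i))) ->
  (forall x y t, 0 <= t <= 1 -> L x -> L y -> L (t *: x + (1 - t) *: y)) ->
  {ae mu, forall x, D x -> L (h x)} ->
  L (\row_i ((fine (mu D))^-1 * \int[mu]_(x in D) h x ord0 i)).
Proof.
move=> mD D0 Doo inth Lconv Lh; set y := \row_i _.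
have m0 : 0 < fine (mu D) by rewrite fine_gt0// D0.
have intc (r : R) : mu.-integrable D (EFin \o cst r).
  apply/integrableP; split; first exact: (measurable_cst r%:E).
  by rewrite (integral_cst mu mD `|r|%:E) lte_mul_pinfty.
suff : [set z | L (z + y)] 0 by rewrite /= add0r.
apply: (mean0_in_convex mD (h := fun x => h x - y) (mu := mu)) => // [i|i|x z t t01 Lx Lz|].
- under eq_fun do rewrite 2!mxE.
  exact: (integrableB mD (inth i) (intc _)).
- under eq_Rintegral do rewrite 2!mxE.
  rewrite RintegralB//; last exact: intc.
  rewrite Rintegral_cst// mxE mulrAC mulVf ?gt_eqF// mul1r.
  by rewrite subrr.
- rewrite /= (_ : _ + y = t *: (x + y) + (1 - t) *: (z + y)); first exact: Lconv.
  by rewrite !scalerDr addrACA -scalerDl addrC [t + _]addrC subrK scale1r addrC.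
- by apply: filterS Lh => x h0 Dx; rewrite /= subrK; exact: h0.
Qed.

(** The hypothesis on alpha says that segments of L with 0 in their interior are
    orthogonal to alpha. The means of h over the sets where <alpha, h> is positive and where
    it is nonpositive lie in L, and 0 is a convex combination of them; if the
    first set had positive measure, their difference would have a positive
    product with alpha. *)
Lemma mean0_extremal_direction (D : set T) n (h : T -> 'rV[R]_n) (L : set 'rV[R]_n)
    (alpha : 'rV[R]_n) :
  measurable D -> (mu D < +oo)%E ->
  (forall i, mu.-integrable D (EFin \o (fun x => h x ord0 i))) ->
  (forall i, \int[mu]_(x in D) h x ord0 i = 0) ->
  (forall x y t, 0 <= t <= 1 -> L x -> L y -> L (t *: x + (1 - t) *: y)) ->
  {ae mu, forall x, D x -> L (h x)} ->
  (forall y z t, 0 < t < 1 -> L y -> L z -> t *: y + (1 - t) *: z = 0 ->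
    dot_rV (y - z) alpha = 0) ->
  {ae mu, forall x, D x -> dot_rV alpha (h x) = 0}.
Proof.
move=> mD Doo inth h0 Lconv Lh Lalpha; pose s x := dot_rV alpha (h x).
have ints : mu.-integrable D (EFin \o s) by exact: integrable_lin.
have s0 : \int[mu]_(x in D) s x = 0.
  by rewrite /s Rintegral_lin// big1// => i _; rewrite h0 mulr0.
have ms : measurable_fun D s by apply/measurable_EFinP; exact: measurable_int ints.
pose P := D `&` s @^-1` `]0, +oo[; pose N := D `&` s @^-1` `]-oo, 0].
have mP : measurable P by exact: ms.
have mN : measurable N by exact: ms.
have DPN : D = P `|` N.
  apply/seteqP; split=> [x Dx|x [[]|[]]]//; have [sx|sx] := ltP 0 (s x).
    by left; split=> //=; rewrite in_itv/= sx.
  by right; split=> //=; rewrite in_itv.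
have PN0 : [disjoint P & N].
  by apply/disj_setPS => x [[_ /=]]; rewrite in_itv/= andbT => + [_ /=];
    rewrite in_itv/= leNgt => ->.
have Ps x : P x -> 0 < s x by case=> _ /=; rewrite in_itv/= andbT.
have Ns x : N x -> s x <= 0 by case=> _ /=; rewrite in_itv.
have PD : P `<=` D by move=> x [].
have ND : N `<=` D by move=> x [].
have muP_oo : (mu P < +oo)%E by apply: le_lt_trans Doo; apply: le_measure; rewrite ?inE.
have muN_oo : (mu N < +oo)%E by apply: le_lt_trans Doo; apply: le_measure; rewrite ?inE.
have muDE : mu D = (mu P + mu N)%E by rewrite DPN measureU//; exact/disj_set2P.
have [muP0|muP0] := eqVneq (mu P) 0%E.
  have sN : {ae mu, forall x, D x -> - s x = 0}.
    apply: Rintegral_eq0_ae => //.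
    - exact: (integrableN ints).
    - exists P; split=> // x /= /not_implyP[Dx /negP]; rewrite oppr_ge0 -ltNge => sx.
      by split=> //=; rewrite in_itv/= sx.
    - under eq_Rintegral do rewrite -mulN1r.
      by rewrite RintegralZl// s0 mulr0.
  by apply: filterS sN => x sx Dx; apply/eqP; rewrite -oppr_eq0; apply/eqP/sx.
have [muN0|muN0] := eqVneq (mu N) 0%E.
  apply: Rintegral_eq0_ae => //.
  exists N; split=> // x /= /not_implyP[Dx /negP]; rewrite -ltNge => /ltW sx.
  by split=> //=; rewrite in_itv.
exfalso.
have {}muP0 : (0 < mu P)%E by rewrite lt_def muP0 measure_ge0.
have {}muN0 : (0 < mu N)%E by rewrite lt_def muN0 measure_ge0.
have inthP i : mu.-integrable P (EFin \o (fun x => h x ord0 i)) by exact: integrableS (inth i).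
have inthN i : mu.-integrable N (EFin \o (fun x => h x ord0 i)) by exact: integrableS (inth i).
have LhP : {ae mu, forall x, P x -> L (h x)} by apply: filterS Lh => x hx /PD.
have LhN : {ae mu, forall x, N x -> L (h x)} by apply: filterS Lh => x hx /ND.
have := mean_in_convex mP muP0 muP_oo inthP Lconv LhP.
have := mean_in_convex mN muN0 muN_oo inthN Lconv LhN.
set p := fine (mu P); set q := fine (mu N).
have p0 : 0 < p by rewrite fine_gt0// muP0.
have q0 : 0 < q by rewrite fine_gt0// muN0.
set z := \row_i _; set y := \row_i _ => Lz Ly.
have pq0 : 0 < p + q by rewrite addr_gt0.
have yz0 : (p / (p + q)) *: y + (1 - p / (p + q)) *: z = 0.
  apply/rowP => i; rewrite !mxE.
  have := h0 i; rewrite DPN Rintegral_setU//; last by rewrite -DPN.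
  set a := \int[mu]_(x in P) _; set b := \int[mu]_(x in N) _ => ab0.
  transitivity ((a + b) / (p + q)); last by rewrite ab0 mul0r.
  by field; rewrite !gt_eqF.
have t01 : 0 < p / (p + q) < 1.
  by rewrite divr_gt0//= ltr_pdivrMr// mul1r ltrDl.
have := Lalpha _ _ _ t01 Ly Lz yz0.
have dotE (E : set T) (r : R) : measurable E ->
    (forall i, mu.-integrable E (EFin \o (fun x => h x ord0 i))) ->
    dot_rV alpha (\row_i (r^-1 * \int[mu]_(x in E) h x ord0 i)) =
    r^-1 * \int[mu]_(x in E) s x.
  move=> mE intE; rewrite /s /dot_rV Rintegral_lin// mulr_sumr; apply: eq_bigr => i _.
  by rewrite mxE mulrCA.
rewrite dot_rVC dot_rVDr -scaleN1r dot_rVZr mulN1r /y /z !dotE//.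
move=> /eqP; rewrite subr_eq0 => /eqP yz.
have sP : 0 < \int[mu]_(x in P) s x.
  rewrite lt_def Rintegral_ge0 ?andbT; last by move=> x /Ps/ltW.
  apply/eqP => sP0; have intsP : mu.-integrable P (EFin \o s) by exact: integrableS ints.
  have := Rintegral_eq0_ae mP intsP _ sP0.
  have H : {ae mu, forall x, P x -> 0 <= s x} by apply/aeW => x /Ps/ltW.
  move=> /(_ H) /(ae_exists mP muP0)[x /Ps + sx0].
  by rewrite sx0 ltxx.
have sN : \int[mu]_(x in N) s x <= 0.
  rewrite -oppr_ge0 -mulN1r -RintegralZl//; last exact: integrableS ints.
  by apply: Rintegral_ge0 => x /Ns; rewrite mulN1r oppr_ge0.
have : 0 < p^-1 * \int[mu]_(x in P) s x by rewrite mulr_gt0 ?invr_gt0.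
by rewrite yz ltNge mulr_ge0_le0// invr_ge0 ltW.
Qed.

End face.

(** * The variational problem *)

Section variational.
Context {R : realType} {n : nat} (Omega : set 'rV[R]_n).
Local Notation mu := (@lebesgue_rV R n).
Hypothesis Omega_open : open Omega.
Let mOmega : measurable Omega := measurable_open_rV Omega_open.

Lemma measure_open_gt0 : Omega !=set0 -> (0 < mu Omega)%E.
Proof.
move=> [x Ox]; have [S [p [pO OE]]] := open_bigcup_obox Omega_open.
move: Ox; rewrite {1}OE => -[k Sk xk].
have ab i : (p k).1 ord0 i < (p k).2 ord0 i.
  by have /andP[h1 h2] := xk i; exact: lt_trans h1 h2.
apply: (@lt_le_trans _ _ (mu (cbox (p k).1 (p k).2))).
  have muK := lebesgue_rV_box (fun i => ltW (ab i)).
  rewrite [X in (_ < X)%E]muK lte_fin prodr_gt0// => i _.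
  by rewrite subr_gt0.
by apply: le_measure; rewrite ?inE//; [exact: measurable_box_rV|exact: pO].
Qed.

Lemma ess_sup_onP (g : 'rV[R]_n -> \bar R) (y : \bar R) :
  (ess_sup_on Omega g <= y)%E <-> {ae mu, forall x, Omega x -> (g x <= y)%E}.
Proof.
split=> [/ess_supP|] gy.
  by apply: filterS gy => x + Ox; rewrite /patch mem_set.
apply/ess_supP; apply: filterS gy => x gx; rewrite /patch.
by case: ifPn => [/set_mem/gx//|_]; rewrite leNye.
Qed.

Lemma W1oo_0_cst0 : W1oo_0 Omega (fun=> 0).
Proof.
have wp0 i : is_weak_partial Omega i (fun=> 0) (fun=> 0).
  have := is_weak_partial_Ck Omega_open i (fun k => @Ck_cst R n k 0).
  rewrite (_ : partial i _ = fun=> 0)//; apply/funext => x.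
  by apply: partialE; exact: is_derive_cst.
have r0 : (fun=> 0 : R) \_ Omega = fun=> 0.
  by apply/funext => x; rewrite patchE if_same.
have L0 p : (p != 0)%E -> Lp_on Omega p (fun=> 0).
  move=> p0; rewrite /Lp_on r0 inE; apply/andP; split; rewrite inE/=.
    exact: measurable_cst.
  by rewrite /finite_norm (_ : EFin \o _ = cst 0%E)// Lnorm0// ltry.
have W0 p : (p != 0)%E -> W1 p Omega (fun=> 0).
  by move=> p0; split=> [|i]; [exact: L0|exists (fun=> 0); [exact: wp0|exact: L0]].
split; [exact: W0|exact: W0|move=> e e0].
exists (fun=> 0); first exact: test_function0.
have N0 (g : 'rV[R]_n -> R) : loc_integrable Omega g ->
    {ae mu, forall x, Omega x -> g x = 0} -> ('N[mu]_1 [EFin \o (g \_ Omega)] = 0)%E.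
  move=> lg g0; rewrite Lnorm1_on.
  have mg : measurable_fun Omega (EFin \o g).
    by apply/measurable_EFinP; exact: loc_integrable_measurable.
  apply/(ae_eq_integral_abs mu mOmega mg).
  by apply: filterS g0 => x h Ox; rewrite /= h.
rewrite /W11_norm (_ : (_ \- _)%R = fun=> 0); last first.
  by apply/funext => x /=; rewrite subr0.
rewrite N0; [|by apply: continuous_loc_integrable; exact: cst_continuous|exact: aeW].
rewrite add0e big1 ?lte_fin// => i _.
by apply: N0; [case: (weak_partialP (wp0 i))|exact: weak_partial_ae].
Qed.

Lemma weak_grad_ae (u : 'rV[R]_n -> R) (v : 'I_n -> 'rV[R]_n -> R) :
  (forall i, is_weak_partial Omega i u (v i)) ->
  {ae mu, forall x, Omega x -> weak_grad Omega u x = \row_i v i x}.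
Proof.
move=> uv; suff : {ae mu, forall x i, Omega x -> weak_partial Omega i u x = v i x}.
  by apply: filterS => x h Ox; apply/rowP => i; rewrite !mxE h.
by apply: filter_forall => i; exact: weak_partial_ae.
Qed.

Variables (xi0 : 'rV[R]_n) (c : R).
Local Notation u0 := (affine_rV xi0 c).

Lemma is_weak_partial_affine i : is_weak_partial Omega i u0 (fun=> xi0 ord0 i).
Proof.
have := is_weak_partial_Ck Omega_open i (fun k => @Ck_affine R n k xi0 c).
by rewrite (_ : partial i _ = fun=> xi0 ord0 i)//; apply/funext => x; rewrite partial_affine.
Qed.

Lemma energy_affine_le (f : 'rV[R]_n -> R) : (energy f Omega u0 <= (f xi0)%:E)%E.
Proof.
apply/ess_sup_onP; apply: filterS (weak_grad_ae is_weak_partial_affine) => x h Ox.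
rewrite h// (_ : \row_i _ = xi0)//.
by apply/rowP => i; rewrite mxE.
Qed.

Lemma admissible_affine : admissible Omega u0 u0.
Proof.
rewrite /admissible /= (_ : (_ \- _)%R = fun=> 0); first exact: W1oo_0_cst0.
by apply/funext => x /=; rewrite subrr.
Qed.

(** The energy involves the representatives chosen by weak_grad; this expresses
    them through integrable ones, to which the facts on W^{1,oo}_0 apply. *)
Lemma admissible_gradient (u : 'rV[R]_n -> R) : admissible Omega u0 u ->
  exists v : 'I_n -> 'rV[R]_n -> R,
  [/\ forall i, is_weak_partial Omega i (u \- u0)%R (v i),
      forall i, mu.-integrable Omega (EFin \o v i),
      mu.-integrable Omega (EFin \o (u \- u0)%R),
      forall i, \int[mu]_(x in Omega) v i x = 0 &
      {ae mu, forall x, Omega x -> weak_grad Omega u x = xi0 + \row_i v i x}].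
Proof.
move=> uadm; have [_ [/(Lp1_integrable Omega_open) intw wv] _] := uadm.
have /choice[v vP] : forall i, exists v, is_weak_partial Omega i (u \- u0)%R v /\
    mu.-integrable Omega (EFin \o v).
  by move=> i; have [v ? /(Lp1_integrable Omega_open)] := wv i; exists v.
have {}wv i := (vP i).1; have intv i := (vP i).2.
exists v; split=> // [i|]; first exact: (W1oo_0_mean_grad Omega_open i uadm).
have uv i : is_weak_partial Omega i u (fun x => v i x + xi0 ord0 i).
  have := is_weak_partialD Omega_open (wv i) (is_weak_partial_affine i).
  by congr is_weak_partial; apply/funext => x /=; rewrite subrK.
apply: filterS (weak_grad_ae uv) => x h Ox; rewrite h//.
by apply/rowP => i; rewrite !mxE addrC.
Qed.

Variable f : 'rV[R]_n -> R.
Hypothesis f_lconv : level_convex f.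

Lemma sublevel_convex r (x y : 'rV[R]_n) t : 0 <= t <= 1 ->
  f (xi0 + x) <= r -> f (xi0 + y) <= r -> f (xi0 + (t *: x + (1 - t) *: y)) <= r.
Proof.
move=> t01 fx fy.
have -> : xi0 + (t *: x + (1 - t) *: y) = t *: (xi0 + x) + (1 - t) *: (xi0 + y).
  by rewrite !scalerDr addrACA -scalerDl addrC [t + _]addrC subrK scale1r addrC.
by apply: le_trans (f_lconv _ _ t01) _; rewrite ge_max fx.
Qed.

(** Apply mean0_in_convex to Dw and to the sublevel set of f at the height of
    the energy, translated by xi0. An infinite energy is either trivial or
    impossible on a set of positive measure. *)
Lemma energy_ge (u : 'rV[R]_n -> R) : Omega !=set0 -> admissible Omega u0 u ->
  ((f xi0)%:E <= energy f Omega u)%E.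
Proof.
move=> /measure_open_gt0 O0 /admissible_gradient[v [_ intv _ v0 gradu]].
have : {ae mu, forall x, Omega x ->
    ((f (xi0 + \row_i v i x))%:E <= energy f Omega u)%E}.
  have /ess_sup_onP := lexx (energy f Omega u).
  by apply: filterS2 gradu => x gu h Ox; rewrite -gu//; exact: h.
case: (energy f Omega u) => [r| |] fr; [|exact: leey|].
  rewrite lee_fin -[xi0]addr0.
  apply: (@mean0_in_convex _ _ _ mu Omega mOmega n (fun x => \row_i v i x)
    [set y | f (xi0 + y) <= r] O0) => //.
  - by move=> i; under eq_fun do rewrite mxE; exact: intv.
  - by move=> i; under eq_Rintegral do rewrite mxE; exact: v0.
  - by move=> x y t t01; exact: sublevel_convex.
by have [x _] := ae_exists mOmega O0 fr; rewrite leNgt ltNyr.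
Qed.

End variational.

Theorem theorem4p11 (R : realType) (n : nat) (Omega : set 'rV[R]_n)
    (Omega_open : open Omega) (Omega_bounded : bounded_set Omega)
    (xi0 : 'rV[R]_n) (c : R) (f : 'rV[R]_n -> R)
    (f_borel : measurable_fun [set: 'rV[R]_n] f)
    (f_level_convex : level_convex f)
    (f_strict : strictly_level_convex_one_direction f xi0) :
  is_solution f Omega (affine_rV xi0 c) (affine_rV xi0 c) /\
  (forall u : 'rV[R]_n -> R, is_solution f Omega (affine_rV xi0 c) u ->
     ae_eq (lebesgue_rV n) Omega u (affine_rV xi0 c)).
Proof.
have mOmega := measurable_open_rV Omega_open.
set u0 := affine_rV xi0 c.
have adm0 : admissible Omega u0 u0 by exact: admissible_affine.
have inf0 : energy f Omega u0 =
    ereal_inf [set energy f Omega v | v in admissible Omega u0].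
  apply/eqP; rewrite eq_le; apply/andP; split; last first.
    by apply: ereal_inf_lbound; exists u0.
  apply/ereal_infP => _ [v vadm <-].
  have [[x Ox]|O0] := pselect (Omega !=set0).
    apply: le_trans (energy_affine_le Omega_open xi0 c f) _.
    by apply: (energy_ge Omega_open f_level_convex _ vadm); exists x.
  (* over the empty set every energy is -oo *)
  apply: (@le_trans _ _ -oo%E); last exact: leNye.
  by apply/ess_sup_onP; apply/aeW => x Ox; case: O0; exists x.
split; first by split.
move=> u [uadm uinf].
have [v [wv intv intw v0 gradu]] := admissible_gradient Omega_open uadm.
have [alpha alpha0 f_alpha] := f_strict.
have fu : {ae lebesgue_rV n, forall x, Omega x -> f (xi0 + \row_i v i x) <= f xi0}.
  have /ess_sup_onP : (energy f Omega u <= (f xi0)%:E)%E.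
    by rewrite uinf -inf0; exact: energy_affine_le.
  by apply: filterS2 gradu => x gu h Ox; rewrite -lee_fin -gu//; exact: h.
have av0 : {ae lebesgue_rV n, forall x, Omega x -> dot_rV alpha (\row_i v i x) = 0}.
  apply: (mean0_extremal_direction (L := [set y | f (xi0 + y) <= f xi0])) => //.
  - exact: bounded_measure_lty.
  - by move=> i; under eq_fun do rewrite mxE; exact: intv.
  - by move=> i; under eq_Rintegral do rewrite mxE; exact: v0.
  - by move=> x y t t01; exact: sublevel_convex.
  move=> y z t t01 fy fz yz0.
  have xiE : xi0 = t *: (xi0 + y) + (1 - t) *: (xi0 + z).
    rewrite !scalerDr addrACA yz0 addr0 -scalerDl addrC subrK.
    by rewrite scale1r.
  have -> : y - z = (xi0 + y) - (xi0 + z) by rewrite opprD addrACA subrr add0r.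
  (* both values are at most f xi0, and level convexity gives the equality *)
  apply: (f_alpha _ _ t t01 xiE); apply/eqP; rewrite eq_le ge_max fy fz andbT.
  have /andP[t0 t1] := t01.
  by rewrite {1}xiE f_level_convex// !ltW.
have : {ae lebesgue_rV n, forall x, Omega x -> (u \- u0)%R x = 0}.
  apply: (W1oo_0_directional_eq0 Omega_open Omega_bounded alpha0 uadm intw wv intv).
  apply: filterS av0 => x h Ox; rewrite -[RHS](h Ox).
  by apply: eq_bigr => i _; rewrite mxE.
by apply: filterS => x h Ox; apply/eqP; rewrite -subr_eq0; apply/eqP; exact: h.
Qed.
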